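(* If $f=\sum_{e\in E}a_ez^e\in\mathcal P$ is not constant, then for each $c\in C$ the fiber $f^{-1}(c)$ is a locally compact subset of $C$, and it is compact if and only if there is a largest $e$ for which $a_e\neq0$. If $f=\sum_{n\in\mathbb Z}a_n\tau^n\in\mathcal F$ is nonzero, then $G=\ker f$ belongs to $\mathcal G$; moreover $G$ is discrete if and only if $a_n=0$ for all sufficiently negative $n$, and $G$ is compact if and only if $a_n=0$ for all sufficiently large $n$.
   Context: Let $p$ be a prime, $q$ a power of $p$, and $C$ an algebraically closed field containing $\mathbb F_q$, complete with respect to a non-archimedean absolute value $|\cdot|$; let $v(z)=-\log|z|$ ($v(0)=+\infty$) and $\Delta_r=\{x\in C:|x|\le r\}$. Let $E=\{mp^n:m,n\in\mathbb Z,m\ge0\}$, with $z^{mp^n}=(z^{1/p^n})^m$. $\mathcal P$ is the set of series $\sum_{e\in E}a_ez^e$ ($a_e\in C$) converging at every $z\in C$ (for each $z$ and $r>0$ only finitely many terms exceed $r$ in absolute value). $\mathcal F\subset\mathcal P$ is the set of series $\sum_{n\in\mathbb Z}a_nz^{q^n}$, written $\sum a_n\tau^n$, converging at every $z\in C$. Fix a real $r>0$. $\mathcal G$ is the collection of sub-$\mathbb F_q$-vector spaces $G\subseteq C$ such that: (1) $G\cap\Delta_r$ is compact; (2) $\int_{G\cap\Delta_r}v=+\infty$, the integral being with respect to a Haar measure on $G\cap\Delta_r$; (3) $G\cap\Delta_r$ has finite or countable index in $G$, and in the countable case, for any system of coset representatives $g_1,g_2,\dots$ one has $|g_n|\to+\infty$.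 *)

(* Defs.v *)
From HB Require Import structures.
From mathcomp Require Import all_boot all_order all_algebra.
From mathcomp Require Import all_classical all_reals all_analysis.
From mathcomp Require summability.

Set Implicit Arguments.
Unset Strict Implicit.
Unset Printing Implicit Defensive.

Import Order.TTheory GRing.Theory Num.Theory.

Local Open Scope classical_set_scope.
Local Open Scope ring_scope.

(* The library's normed structures require [`|x *+ n| = `|x| *+ n], which fails
   in positive characteristic, hence a separate structure.  The trivial absolute
   value is allowed. *)
HB.mixin Record hasNonarchAbs (R : realType) C of GRing.Field C := {
  abs : C -> R ;
  abs_ge0 : forall x, 0 <= abs x ;
  abs_eq0 : forall x, (abs x == 0) = (x == 0) ;
  absM : forall x y, abs (x * y) = abs x * abs y ;
  absD_max : forall x y, abs (x + y) <= Num.max (abs x) (abs y)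
}.

#[short(type="nonarchClosedFieldType")]
HB.structure Definition NonarchClosedField (R : realType) :=
  {C of GRing.ClosedField C & hasNonarchAbs R C}.

Section AbsMetric.
Context {R : realType} {C : nonarchClosedFieldType R}.
Implicit Types x y z : C.

Lemma abs0 : abs (0 : C) = 0.
Proof. by apply/eqP; rewrite abs_eq0. Qed.

Lemma absN x : abs (- x) = abs x.
Proof.
suff abs_sq1 : forall u : C, u * u = 1 -> abs u = 1.
  by rewrite -mulN1r absM (abs_sq1 (-1)) ?mul1r // mulrNN mulr1.
move=> u uu; have u2 : abs u ^+ 2 = 1.
  have n0 : abs (1 : C) != 0 by rewrite abs_eq0 oner_eq0.
  by rewrite expr2 -absM uu; apply: (mulfI n0); rewrite -absM !mulr1.
by apply/eqP; rewrite -(@pexpr_eq1 _ _ 2) ?abs_ge0 // u2.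
Qed.

Definition absdist x y : R := abs (x - y).

Lemma absdistxx x : absdist x x = 0.
Proof. by rewrite /absdist subrr abs0. Qed.

Lemma absdist_positivity x y : absdist x y = 0 -> x = y.
Proof. by move/eqP; rewrite abs_eq0 subr_eq0 => /eqP. Qed.

Lemma absdist_sym x y : absdist x y = absdist y x.
Proof. by rewrite /absdist -absN opprB. Qed.

Lemma absdist_triangle y x z : absdist x z <= absdist x y + absdist y z.
Proof.
rewrite /absdist -(subrKA y) (le_trans (absD_max _ _)) //.
by rewrite ge_max lerDl lerDr !abs_ge0.
Qed.

HB.instance Definition _ := isPointed.Build (NonarchClosedField.sort C) 0.
HB.instance Definition _ := isMetric.Build R (NonarchClosedField.sort C)
  absdistxx absdist_positivity absdist_sym absdist_triangle.

End AbsMetric.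

(* The axiom of the library's completeType. *)
Definition complete_space (T : puniformType) :=
  forall F : set_system T, ProperFilter F -> cauchy F -> cvg F.

Definition expoE (p : nat) : set rat :=
  [set e | exists (m : nat) (n : int), e = m%:R * p%:R ^ n].

Section Series.
Context {R : realType} {C : nonarchClosedFieldType R}.

(* z ^ (u / d) = (z ^ (1 / d)) ^ u with u / d in lowest terms.  It is only used
   for exponents in [expoE p], p the characteristic of C: then d is a power
   of p and the d-th root exists and is unique. *)
Definition rootn (d : nat) (z : C) : C := xget 0 [set y | y ^+ d = z].

Definition powE (z : C) (e : rat) : C := rootn `|denq e| z ^+ `|numq e|.

Definition tends_to_0 (I : choiceType) (u : I -> C) :=
  forall eps : R, 0 < eps -> finite_set [set i | eps < abs (u i)].

(* Unordered sum: limit of the partial sums over finite subsets of I. *)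
Definition usum (I : choiceType) (u : I -> C) : C :=
  lim (summability.partial_sum u @ summability.totally).

Definition termP (p : nat) (a : expoE p -> C) (z : C) (e : expoE p) : C :=
  a e * powE z (val e).

Definition inP (p : nat) (a : expoE p -> C) :=
  forall z : C, tends_to_0 (termP a z).

Definition evalP (p : nat) (a : expoE p -> C) (z : C) : C := usum (termP a z).

Definition termF (q : nat) (a : int -> C) (z : C) (n : int) : C :=
  a n * powE z (q%:R ^ n).

Definition inF (q : nat) (a : int -> C) :=
  forall z : C, tends_to_0 (termF q a z).

Definition evalF (q : nat) (a : int -> C) (z : C) : C := usum (termF q a z).

Definition kerF (q : nat) (a : int -> C) : set C := evalF q a @^-1` [set 0].

End Series.

(* Local compactness in the subspace topology.  The library's [locally_compact A]
   for a set A only asks for a compact subset of the ambient space containing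
   a neighborhood of x in A, so it is applied to the subtype. *)
Definition locally_compact_subset (T : topologicalType) (A : set T) :=
  locally_compact [set: A].

Definition discrete_subset (T : topologicalType) (A : set T) :=
  A `<=` isolated A.

Definition borelType (R : realType) (C : nonarchClosedFieldType R) :=
  g_sigma_algebraType (@open C).

Section ClassG.
Context {R : realType} {C : nonarchClosedFieldType R}.

Definition valuation (z : C) : \bar R := if z == 0 then +oo%E else (- ln (abs z))%:E.

Definition Delta (r : R) : set C := [set x | abs x <= r].

(* H is a compact subgroup of C; a Borel measure on H is encoded as a Borel
   measure on C carried by H. *)
Definition haar_on (H : set C) (mu : {measure set (borelType C) -> \bar R}) :=
  [/\ mu (~` H) = 0%E,
      (0 < mu H)%E,
      (mu H < +oo)%E
    & forall (h : C) (A : set C), H h -> A `<=` H ->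
        measurable (A : set (borelType C)) ->
        mu [set h + x | x in A] = mu A].

Definition Fq_subspace (k : finFieldType) (iota : {rmorphism k -> C})
    (G : set C) :=
  [/\ G 0,
      forall x y, G x -> G y -> G (x + y)
    & forall (l : k) x, G x -> G (iota l * x)].

Definition cosets (G H : set C) : set (set C) :=
  [set [set x + h | h in H] | x in G].

Definition coset_reps (G H : set C) (g : nat -> C) :=
  (forall n, G (g n)) /\ forall x, G x -> exists! n, H (x - g n).

(* An enumeration [g] indexed by nat exists only when the index is countably
   infinite, so the last clause concerns exactly the infinite case. *)
Definition inG (k : finFieldType) (iota : {rmorphism k -> C}) (r : R)
    (G : set C) :=
  let H := G `&` Delta r in
  [/\ Fq_subspace iota G,
      compact H,
      exists mu : {measure set (borelType C) -> \bar R},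
        haar_on H mu /\ (\int[mu]_(x in H) valuation x)%E = +oo%E,
      countable (cosets G H)
    & forall g : nat -> C, coset_reps G H g -> abs (g n) @[n --> \oo] --> +oo].

End ClassG.

(* Main.v *)
(** Let [rho > 0] and let [m] be the largest exponent at which the maximum of
    [|a_e| rho ^ e] is attained. A finite truncation of [f] is a polynomial in
    [z ^ (1 / p ^ N)]; by the Newton polygon it has [m p ^ N] roots in the disc
    of radius [rho], and on that disc it is up to [|a_m|] the product of the
    distances to them. An approximate zero is therefore within [(|f z| / |a_m|)
    ^ (1 / m)] of a root of any finer truncation. This makes the zeros in the
    disc totally bounded, and iterating it produces a genuine zero near each
    root of a truncation; so as soon as [m] increases between two radii, [f] has
    a zero between them. Compactness and discreteness of the zero set are read
    off from the behaviour of [m] as [rho] tends to infinity or 0.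

    For an additive series the translates of a truncation by its zeros have the
    same roots, so the zeros in the disc of radius [r] split into at most [m(r)
    / m(rho)] cosets of those in the disc of radius [rho]. The integral of [v]
    is then bounded below by a multiple of the sum of [m(r / 2 ^ j)], which
    diverges because [m] is the logarithmic derivative of the Gauss norm of [f],
    and the latter tends to 0 with the radius. *)

Require Import Defs.
From HB Require Import structures.
From mathcomp Require Import all_boot all_order all_algebra finmap all_field.
From mathcomp Require Import all_classical all_reals all_analysis.
From mathcomp Require Import measurable_realfun.
From mathcomp Require summability.

Set Implicit Arguments.
Unset Strict Implicit.
Unset Printing Implicit Defensive.

Import Order.TTheory GRing.Theory Num.Theory.

Local Open Scope classical_set_scope.
Local Open Scope ring_scope.

(** * Non-archimedean absolute values and polynomials *)

(** The exponents in [expoE p] are dense in the nonnegative reals, so division arguments for power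
    series do not apply, and [C] is in general not locally compact, so closed and bounded sets need
    not be compact. What makes truncations usable is Frobenius: x -> x ^ (p ^ N) is an additive
    bijection of [C] raising every distance to the power p ^ N. Roots of a polynomial in z ^ (1 / p
    ^ N) thus transfer to points of [C] with exact control of distances, and the exponent [e i]
    reappears as the number of roots divided by p ^ N, so that the root estimates do not depend on
    the N a truncation needs. Compactness then comes from completeness and total boundedness. A
    fiber over c is handled as the zero set of f - c. The Haar measure is built explicitly by
    counting cosets of H [&] Delta (rho j), so that the measure of such a subgroup is controlled by
    the same counts as the roots. *)

Section Abs.
Context {R : realType} {C : nonarchClosedFieldType R}.
Implicit Types x y z : C.

Lemma abs_gt0 x : (0 < abs x) = (x != 0).
Proof. by rewrite lt_neqAle abs_ge0 andbT eq_sym abs_eq0. Qed.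

Lemma abs1 : abs (1 : C) = 1.
Proof.
have n0 : abs (1 : C) != 0 by rewrite abs_eq0 oner_eq0.
by apply: (mulfI n0); rewrite -absM !mulr1.
Qed.

Lemma absX x n : abs (x ^+ n) = abs x ^+ n.
Proof. by elim: n => [|n ih]; rewrite ?expr0 ?abs1// !exprS absM ih. Qed.

Lemma absBC x y : abs (x - y) = abs (y - x).
Proof. by rewrite -absN opprB. Qed.

Lemma absD_le x y t : abs x <= t -> abs y <= t -> abs (x + y) <= t.
Proof. by move=> xt yt; rewrite (le_trans (absD_max _ _))// ge_max xt yt. Qed.

Lemma absB_le x y t : abs x <= t -> abs y <= t -> abs (x - y) <= t.
Proof. by move=> xt yt; apply: absD_le; rewrite ?absN. Qed.

Lemma absD_lt x y t : abs x < t -> abs y < t -> abs (x + y) < t.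
Proof. by move=> xt yt; rewrite (le_lt_trans (absD_max _ _))// gt_max xt yt.
  Qed.

Lemma absB_lt x y t : abs x < t -> abs y < t -> abs (x - y) < t.
Proof. by move=> xt yt; apply: absD_lt; rewrite ?absN. Qed.

Lemma absB_trans y x z t : abs (x - y) <= t -> abs (y - z) <= t ->
  abs (x - z) <= t.
Proof. by move=> xy yz; rewrite -(subrKA y) absD_le. Qed.

Lemma absDl x y : abs y < abs x -> abs (x + y) = abs x.
Proof.
move=> yx; apply/eqP; rewrite eq_le absD_le ?(ltW yx)//= leNgt; apply/negP => h.
by have := absB_lt h yx; rewrite addrK ltxx.
Qed.

Lemma absDr x y : abs x < abs y -> abs (x + y) = abs y.
Proof. by rewrite addrC; exact: absDl. Qed.

Lemma absBl x y : abs y < abs x -> abs (x - y) = abs x.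
Proof. by move=> ?; apply: absDl; rewrite absN. Qed.

Lemma absBr x y : abs x < abs y -> abs (x - y) = abs y.
Proof. by move=> ?; rewrite absDr absN. Qed.

Lemma abs_sum_le I (s : seq I) (P : pred I) (u : I -> C) (t : R) : 0 <= t ->
  (forall i, P i -> abs (u i) <= t) -> abs (\sum_(i <- s | P i) u i) <= t.
Proof.
move=> t0 ut; elim/big_ind : _ => //; first by rewrite abs0.
by move=> *; exact: absD_le.
Qed.

Lemma abs_prod I (s : seq I) (P : pred I) (u : I -> C) :
  abs (\prod_(i <- s | P i) u i) = \prod_(i <- s | P i) abs (u i).
Proof. by apply: (big_morph _ absM abs1). Qed.

Lemma abs_le0_eq x : (forall eps : R, 0 < eps -> abs x <= eps) -> x = 0.
Proof.
move=> h; apply/eqP; rewrite -abs_eq0 eq_le abs_ge0 andbT.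
by apply/ler_addgt0Pl => eps /h; rewrite addr0.
Qed.

(* [m] is the largest index at which the Gauss norm of [P] on the disc of
   radius [rho] is attained, i.e. the Weierstrass degree of [P] on that
   disc. *)
Definition weierstrass_index (P : {poly C}) (rho : R) (m : nat) :=
  (forall j, abs P`_j * rho ^+ j <= abs P`_m * rho ^+ m) /\
  (forall j, (m < j)%N -> abs P`_j * rho ^+ j < abs P`_m * rho ^+ m).

(** Root counts come from this: the index is computed once from the roots and once from the
    coefficients. *)
Lemma weierstrass_index_uniq P rho m n :
  weierstrass_index P rho m -> weierstrass_index P rho n -> m = n.
Proof.
move=> [m1 m2] [n1 n2]; case: (ltngtP m n) => // mn.
  by have := m2 _ mn; rewrite ltNge n1.
by have := n2 _ mn; rewrite ltNge m1.
Qed.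

Lemma coef_XsubCM (x : C) (P : {poly C}) j :
  (('X - x%:P) * P)`_j = (if j is j'.+1 then P`_j' else 0) - x * P`_j.
Proof. by rewrite mulrBl coefB coefCM mulrC coefMX; case: j. Qed.

(** As |x| <= rho, the new weight at j is at most rho times the larger of the old weights at j - 1
    and j, so the peak moves to m + 1; there P_m is not cancelled, because the old weight at m + 1
    was strictly smaller. *)
Lemma weierstrass_index_XsubCM_le (P : {poly C}) (rho : R) m (x : C) :
  0 < rho -> abs x <= rho -> weierstrass_index P rho m ->
  weierstrass_index (('X - x%:P) * P) rho m.+1 /\ abs (('X - x%:P) * P)`_m.+1 =
    abs P`_m.
Proof.
move=> rho0 xr [ih1 ih2].
have pos n : 0 < rho ^+ n by rewrite exprn_gt0.
set M := abs P`_m * rho ^+ m in ih1 ih2.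
have M0 : 0 <= M by rewrite mulr_ge0 ?abs_ge0// ltW.
have xP : abs (x * P`_m.+1) < abs P`_m.
  rewrite -(ltr_pM2r (pos m.+1)) absM -mulrA [in ltRHS]exprS [ltRHS]mulrCA.
  rewrite (@le_lt_trans _ _ (rho * (abs P`_m.+1 * rho ^+ m.+1)))//.
    by rewrite ler_wpM2r// mulr_ge0 ?abs_ge0// ltW.
  by rewrite ltr_pM2l// ih2.
have Em : abs (('X - x%:P) * P)`_m.+1 = abs P`_m by rewrite coef_XsubCM absBl.
have EM : abs P`_m * rho ^+ m.+1 = rho * M by rewrite exprS mulrCA.
split => //; split => j; rewrite Em EM coef_XsubCM.
- rewrite -ler_pdivlMr ?pos//; apply: absB_le; rewrite ler_pdivlMr ?pos//.
    case: j => [|j]; first by rewrite abs0 mul0r mulr_ge0// ltW.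
    by rewrite exprS mulrCA ler_pM2l.
  by rewrite absM -mulrA ler_pM ?abs_ge0 ?mulr_ge0 ?abs_ge0// ltW.
- case: j => [|j]// mj; rewrite ltnS in mj.
  rewrite -ltr_pdivlMr ?pos//; apply: absB_lt; rewrite ltr_pdivlMr ?pos//.
    by rewrite exprS mulrCA ltr_pM2l// ih2.
  rewrite absM -mulrA (@le_lt_trans _ _ (rho * (abs P`_j.+1 * rho ^+ j.+1)))//.
    by rewrite ler_wpM2r// mulr_ge0 ?abs_ge0// ltW.
  by rewrite ltr_pM2l// ih2// ltnW.
Qed.

(** Since |x| > rho, the summand x * P_m now outweighs P_(m-1): the peak stays at m and its
    coefficient grows by |x|. *)
Lemma weierstrass_index_XsubCM_gt (P : {poly C}) (rho : R) m (x : C) :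
  0 < rho -> rho < abs x -> 0 < abs P`_m -> weierstrass_index P rho m ->
  weierstrass_index (('X - x%:P) * P) rho m /\ abs (('X - x%:P) * P)`_m = abs x
    * abs P`_m.
Proof.
move=> rho0 xr Pm0 [ih1 ih2].
have pos n : 0 < rho ^+ n by rewrite exprn_gt0.
set M := abs P`_m * rho ^+ m in ih1 ih2.
have M0 : 0 < M by rewrite mulr_gt0.
have x0 : 0 < abs x by rewrite (lt_trans rho0).
have MrM : rho * M < abs x * M by rewrite ltr_pM2r.
have xP : abs (if m is j'.+1 then P`_j' else 0) < abs (x * P`_m).
  case: {-2}m (erefl m) => [|j] mj; first by rewrite abs0 absM mj mulr_gt0.
  rewrite -(ltr_pM2r (pos j.+1)) absM -[ltRHS]mulrA [in ltRHS]mj -/M.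
  by rewrite (le_lt_trans _ MrM)// exprS mulrCA ler_pM2l.
have Em : abs (('X - x%:P) * P)`_m = abs x * abs P`_m.
  by rewrite coef_XsubCM absBr// absM.
have EM : abs x * abs P`_m * rho ^+ m = abs x * M by rewrite mulrA.
split => //; split => j; rewrite Em EM coef_XsubCM.
- rewrite -ler_pdivlMr ?pos//; apply: absB_le; rewrite ler_pdivlMr ?pos//.
    case: j => [|j]; first by rewrite abs0 mul0r mulr_ge0 ?ltW.
    by rewrite exprS mulrCA (le_trans _ (ltW MrM))// ler_pM2l.
  by rewrite absM -mulrA ler_pM2l.
- case: j => [|j]// mj; rewrite ltnS in mj.
  rewrite -ltr_pdivlMr ?pos//; apply: absB_lt; rewrite ltr_pdivlMr ?pos//.
    by rewrite exprS mulrCA (le_lt_trans _ MrM)// ler_pM2l.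
  by rewrite absM -mulrA ltr_pM2l// ih2.
Qed.

(** The roots are multiplied in one at a time: one in the disc raises the index by 1, one outside
    scales the peak coefficient. *)
Lemma weierstrass_index_prod (c : C) (s : seq C) (rho : R) :
  c != 0 -> 0 < rho ->
  let P := c *: \prod_(x <- s) ('X - x%:P) in
  let m := count (fun x => abs x <= rho) s in
  [/\ 0 < abs P`_m, weierstrass_index P rho m &
    abs P`_m = abs c * \prod_(x <- s | rho < abs x) abs x].
Proof.
move=> c0 rho0 /=; elim: s => [|x s [ih0 ih1 ih2]].
  rewrite !big_nil alg_polyC mulr1 coefC eqxx abs_gt0; split => //.
  split => j; rewrite !coefC; case: j => [|j]//=.
  + by rewrite abs0 mul0r expr0 mulr1 abs_ge0.
  + by move=> _; rewrite abs0 mul0r expr0 mulr1 abs_gt0.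
rewrite !big_cons scalerAr /=.
case: (leP (abs x) rho) => xr.
  have [? E] := weierstrass_index_XsubCM_le rho0 xr ih1.
  by rewrite add1n; split => //; rewrite E.
have [? E] := weierstrass_index_XsubCM_gt rho0 xr ih0 ih1.
rewrite add0n; split => //; rewrite E; last by rewrite ih2 mulrCA.
by rewrite mulr_gt0// (lt_trans rho0).
Qed.

(** A root x outside the disc has |w - x| = |x|, and the product of these |x| is exactly the ratio
    of the peak coefficient to c. *)
Lemma abs_horner_roots (c : C) (s : seq C) (rho : R) (w : C) :
  c != 0 -> 0 < rho -> abs w <= rho ->
  let P := c *: \prod_(x <- s) ('X - x%:P) in
  let m := count (fun x => abs x <= rho) s in
  abs P.[w] = abs P`_m * \prod_(x <- s | abs x <= rho) abs (w - x).
Proof.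
move=> c0 rho0 wr /=; have [_ _ ->] := weierstrass_index_prod s c0 rho0.
rewrite hornerZ horner_prod absM -mulrA; congr (_ * _).
rewrite abs_prod (bigID (fun x => rho < abs x))/=; congr (_ * _).
  apply: eq_bigr => x xr; rewrite !hornerE absBr//.
  exact: le_lt_trans wr xr.
by apply: eq_big => [x|x _]; rewrite ?hornerE// leNgt.
Qed.

(** Only the coefficient at 0 < m changes, and it need not be strictly below the peak. Translates of
    an additive polynomial differ from it by such a constant. *)
Lemma weierstrass_indexDC (P : {poly C}) (c : C) (rho : R) m : (0 < m)%N ->
  abs c < abs P`_m * rho ^+ m -> weierstrass_index P rho m ->
  weierstrass_index (P + c%:P) rho m.
Proof.
move=> m0 cm [le_m lt_m].
have coefE j : (0 < j)%N -> (P + c%:P)`_j = P`_j.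
  by case: j => // j _; rewrite coefD coefC addr0.
rewrite /weierstrass_index coefE//; split => -[|j].
- have := le_m 0%N; rewrite coefD coefC eqxx !expr0 !mulr1 => P0.
  by apply: absD_le => //; exact: ltW.
- by rewrite coefE.
- by [].
- by rewrite coefE// => /lt_m.
Qed.

Lemma prod_gt_exp (I : eqType) (s : seq I) (u : I -> R) (t : R) : 0 <= t ->
  (forall i, i \in s -> t < u i) -> (0 < size s)%N ->
  t ^+ size s < \prod_(i <- s) u i.
Proof.
move=> t0; elim: s => [|x s ih]// tu _; rewrite big_cons exprS.
have tx : t < u x by rewrite tu ?mem_head.
case: s => [|y s] in ih tu *; first by rewrite big_nil expr0 !mulr1.
by rewrite ltr_pM ?exprn_ge0// ih// => i si; rewrite tu// inE si orbT.
Qed.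

(** Otherwise each of the m distances to roots in the disc exceeds t, hence their product exceeds t
    ^ m. *)
Lemma exists_close_root (c : C) (s : seq C) (rho : R) (w : C) (t : R) :
  c != 0 -> 0 < rho -> abs w <= rho ->
  let P := c *: \prod_(x <- s) ('X - x%:P) in
  let m := count (fun x => abs x <= rho) s in
  (0 < m)%N -> 0 <= t -> abs P.[w] <= abs P`_m * t ^+ m ->
  exists x, [/\ x \in s, abs x <= rho & abs (w - x) <= t].
Proof.
move=> c0 rho0 wr P m m0 t0 Pw; apply: contrapT => no.
have [Pm0 _ _] := weierstrass_index_prod s c0 rho0.
move: Pw; rewrite (abs_horner_roots s c0 rho0 wr) ler_pM2l//.
apply/negP; rewrite -ltNge /m -size_filter -big_filter.
apply: prod_gt_exp => //; last by rewrite size_filter.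
move=> x; rewrite mem_filter => /andP[xr xs].
by rewrite ltNge; apply/negP => xt; apply: no; exists x.
Qed.

End Abs.

(** * Unordered sums and fractional powers *)

Section Sums.
Context {R : realType} {C : nonarchClosedFieldType R}.

Lemma ball_absE (x : C) (eps : R) (y : C) : ball x eps y = (abs (x - y) < eps)
  :> Prop.
Proof. by rewrite ballEmdist. Qed.

Lemma fsum_sub_le (I : choiceType) (u : I -> C) (eps : R) (J K : {fset I}) :
  0 <= eps -> (forall i, eps < abs (u i) -> i \in J) -> (J `<=` K)%fset ->
  abs (\sum_(i <- K) u i - \sum_(i <- J) u i) <= eps.
Proof.
move=> eps0 Jeps JK; rewrite (bigID (mem J))/=.
have -> : \sum_(i <- K | i \in J) u i = \sum_(i <- J) u i.
  rewrite -big_filter; apply: perm_big; apply: uniq_perm.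
  - exact/filter_uniq/fset_uniq.
  - exact: fset_uniq.
  - move=> i; rewrite mem_filter; apply: andb_idr; exact: (fsubsetP JK).
rewrite addrAC subrr add0r; apply: abs_sum_le => // i iJ.
by rewrite leNgt; apply: contra iJ; exact: Jeps.
Qed.

(** All later knowledge of [usum] passes through this estimate; the ultrametric inequality bounds a
    tail by its largest term. *)
Lemma usum_approx (I : choiceType) (u : I -> C) (eps : R) (J : {fset I}) :
  complete_space C -> tends_to_0 u ->
  0 < eps -> (forall i, eps < abs (u i) -> i \in J) ->
  abs (usum u - \sum_(i <- J) u i) <= eps.
Proof.
move=> Ccomplete u0 eps0 Jeps.
pose F := summability.partial_sum u @ summability.totally.
have partE K : summability.partial_sum u K = \sum_(i <- K) u i.
  by rewrite /summability.partial_sum (big_seq_fsetE _ _ xpredT).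
have FF : ProperFilter F by apply: fmap_proper_filter;
  exact: summability.totally_filter.
have Fcauchy : cauchy F.
  apply: cauchy_exP => e e0; have e20 : 0 < e / 2 by rewrite divr_gt0.
  pose K := fset_set [set i | e / 2 < abs (u i)].
  exists (\sum_(i <- K) u i); exists K => // L /= KL.
  rewrite ball_absE partE absBC (@le_lt_trans _ _ (e / 2))//; last first.
    by rewrite ltr_pdivrMr// ltr_pMr// ltr1n.
  apply: fsum_sub_le => //; first exact: ltW.
  by move=> i ei; rewrite in_fset_set ?inE//; exact: u0.
have Fl : F --> usum u by apply: Ccomplete.
have : F (ball (usum u) eps) by apply: Fl; exact: nbhsx_ballx.
(* [J] need not contain [K]; the limit and the sum over [J] are both compared with the sum over the
   union. *)
move=> [K _ KF]; have /= := KF (K `|` J)%fset (fsubsetUl _ _).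
rewrite ball_absE partE => h; apply: (absB_trans (ltW h)).
by apply: fsum_sub_le => //; [exact: ltW|exact: fsubsetUr].
Qed.

End Sums.

Section FractionalPowers.
Context {R : realType} {C : nonarchClosedFieldType R} (p : nat).
Hypotheses (p_pr : prime p) (pC : p \in [pchar C]).
Implicit Types z w : C.

Lemma expDpX N (x y : C) : (x + y) ^+ (p ^ N) = x ^+ (p ^ N) + y ^+ (p ^ N).
Proof. by rewrite exprDn_pchar// pnatX pnatE// pC. Qed.

Lemma expBpX N (x y : C) : (x - y) ^+ (p ^ N) = x ^+ (p ^ N) - y ^+ (p ^ N).
Proof.
rewrite expDpX; congr (_ + _); apply: exprNn_pchar.
by rewrite pnatX pnatE// pC.
Qed.

Lemma exppX_inj N : injective (fun x : C => x ^+ (p ^ N)).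
Proof.
move=> x y /= /eqP; rewrite -subr_eq0 -expBpX expf_eq0 => /andP[_].
by rewrite subr_eq0 => /eqP.
Qed.

Lemma exists_root (d : nat) z : (0 < d)%N -> exists w, w ^+ d = z.
Proof.
move=> d0; have : size ('X^d - z%:P) != 1 by rewrite size_XnsubC// eqSS -lt0n.
move=> /closed_rootP[w]; rewrite /root !hornerE subr_eq0 => /eqP;
  exists w => //.
Qed.

(** Frees [powE] from lowest terms: the reduced denominator divides p ^ N, and p ^ k-th roots are
    unique because Frobenius is injective. *)
Lemma powE_root z w (e : rat) N d : w ^+ (p ^ N) = z ->
  e * (p ^ N)%:R = d%:R -> powE z e = w ^+ d.
Proof.
move=> wz ed.
have nd : (numq e * (p ^ N)%:Z = d%:Z * denq e)%R.
  apply/eqP; rewrite -(eqr_int rat) !rmorphM /= -[(p ^ N)%:Z%:~R]/((p ^ N)%:R).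
  rewrite -[d%:Z%:~R]/(d%:R) -ed -{2}(divq_num_den e) mulrAC.
  by rewrite divfK// intr_eq0 denq_neq0.
have nd' : (`|numq e| * p ^ N = d * `|denq e|)%N.
  by have := congr1 absz nd; rewrite !abszM.
have dvd : (`|denq e| %| p ^ N)%N.
  rewrite -(@Gauss_dvdr _ `|numq e|) ?nd' ?dvdn_mull//.
  by rewrite coprime_sym coprime_num_den.
have [k kN dE] := dvdn_pfactor _ _ p_pr dvd.
have pk0 : (0 < p ^ k)%N by rewrite expn_gt0 prime_gt0.
rewrite /powE dE; set y := rootn _ _.
have yz : y ^+ (p ^ k) = z by exact: (xgetPex 0 (exists_root z pk0)).
have -> : y = w ^+ (p ^ (N - k)).
  by apply: (@exppX_inj k); rewrite -exprM -expnD subnK// wz.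
rewrite -exprM; congr (_ ^+ _); apply/eqP.
rewrite -(eqn_pmul2r pk0) -dE -nd' dE mulnAC -expnD subnK// mulnC//.
Qed.

Lemma expoE_scale (e : rat) : expoE p e ->
  exists N, forall M, (N <= M)%N -> exists d : nat, e * (p ^ M)%:R = d%:R.
Proof.
move=> [m [n ->]]; have p0 : p%:R != 0 :> rat by rewrite pnatr_eq0 -lt0n
  prime_gt0.
case: n => n; [exists 0%N|exists n.+1] => M nM.
  by exists (m * p ^ n * p ^ M)%N; rewrite !natrM !natrX.
exists (m * p ^ (M - n.+1))%N.
rewrite NegzE -exprnN -[M in LHS](subnK nM) expnD !natrM !natrX -!mulrA;
  congr (_ * _).
by rewrite mulrCA mulVf ?mulr1// expf_neq0.
Qed.

Lemma expoE_scale_seq (s : seq rat) : {in s, forall e, expoE p e} ->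
  exists N, {in s, forall e, exists d : nat, e * (p ^ N)%:R = d%:R}.
Proof.
move=> sE; suff : exists N, forall M, (N <= M)%N ->
  {in s, forall e, exists d : nat, e * (p ^ M)%:R = d%:R}.
  by move=> [N /(_ N (leqnn N))]; exists N.
elim: s sE => [|e s ih] sE; first by exists 0%N.
have [|N NP] := ih; first by move=> x xs; apply: sE; rewrite inE xs orbT.
have [N' NP'] := expoE_scale (sE _ (mem_head _ _)).
exists (maxn N N') => M; rewrite geq_max => /andP[NM N'M] x.
by rewrite inE => /orP[/eqP ->|]; [exact: NP'|exact: NP].
Qed.

Lemma expoE_ge0 e : expoE p e -> 0 <= e.
Proof. by move=> [m [n ->]]; rewrite mulr_ge0// exprz_ge0. Qed.

Lemma abs_powE z e : expoE p e -> abs (powE z e) = abs z `^ ratr e.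
Proof.
move=> /expoE_scale[N /(_ N (leqnn N))[d ed]].
have pN0 : (0 < p ^ N)%N by rewrite expn_gt0 prime_gt0.
have [w wz] := exists_root z pN0.
rewrite (powE_root wz ed) absX -wz absX -powR_mulrn ?abs_ge0//.
rewrite -powR_mulrn ?abs_ge0// -powRrM; congr (_ `^ _).
by rewrite -(ratr_nat _ d) -ed rmorphM /= ratr_nat mulrC.
Qed.

End FractionalPowers.

(** * Compactness *)

Section UltrametricTopology.
Context {R : realType} {C : nonarchClosedFieldType R}.
Implicit Types (A : set C) (x y z : C).

Definition totally_bounded A := forall eps : R, 0 < eps ->
  exists s : seq C, forall z, A z -> exists2 y, y \in s & abs (z - y) <= eps.

Lemma sub_totally_bounded A B : A `<=` B -> totally_bounded B ->
  totally_bounded A.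
Proof. by move=> AB tb eps /tb[s sP]; exists s => z /AB/sP. Qed.

Lemma open_absP A :
  (forall z, A z -> exists2 eps : R, 0 < eps & forall y, abs (z - y) < eps ->
    A y) ->
  open A.
Proof.
move=> h; rewrite openE => z /h[eps eps0 zP]; apply/nbhs_ballP.
by exists eps => // y; rewrite ball_absE; exact: zP.
Qed.

Lemma open_abs_nbhs A z : open A -> A z ->
  exists2 eps : R, 0 < eps & forall y, abs (z - y) < eps -> A y.
Proof.
move=> oA Az; have /nbhs_ballP[eps eps0 zP] : nbhs z A by exact: open_nbhs_nbhs.
by exists eps => // y zy; apply: zP; rewrite ball_absE.
Qed.

Lemma open_abs_ball x (eps : R) : open (ball x eps).
Proof.
apply: open_absP => z; rewrite ball_absE => xz; exists eps.
  by rewrite (le_lt_trans _ xz) ?abs_ge0.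
by move=> y zy; rewrite ball_absE -(subrKA z) absD_lt.
Qed.

Lemma closed_absP A :
  (forall z, (forall eps : R, 0 < eps -> exists2 x, A x & abs (z - x) < eps) ->
    A z) ->
  closed A.
Proof.
move=> h z clz; apply: h => eps eps0.
by have [x [Ax]] := clz _ (nbhsx_ballx z _ eps0); rewrite ball_absE; exists x.
Qed.

Lemma closed_Delta (rho : R) : 0 < rho -> closed (Delta rho : set C).
Proof.
move=> r0; apply: closed_absP => z /(_ _ r0)[x xr zx].
by rewrite /Delta /= -(subrK x z) absD_le// ltW.
Qed.

(** An ultrafilter on [A] contains one ball of every finite cover of [A], so it is Cauchy and
    converges. *)
Lemma compact_totally_bounded A :
  complete_space C -> closed A -> totally_bounded A -> compact A.
Proof.
move=> Ccomplete clA tbA; rewrite compact_ultra => F FU FA.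
have big_ultra (s : seq C) (eps : R) :
    F [set z | exists2 y, y \in s & abs (z - y) <= eps] ->
    exists y, F [set z | abs (z - y) <= eps].
  elim: s => [|x s ih].
    by move=> F0; have /filter_ex[z [y]] : F [set z | exists2 y,
      y \in [::] & abs (z - y) <= eps] by [].
  move=> Fs; have [Fx|Fx] := in_ultra_setVsetC [set z | abs (z - x) <= eps] FU.
    by exists x.
  apply: ih; apply: filterS (filterI Fs Fx) => z /= [[y]].
  by rewrite inE => /predU1P[->//|ys zy _]; exists y.
have Fc : cauchy F.
  apply: cauchy_exP => eps eps0; have e2 : 0 < eps / 2 by rewrite divr_gt0.
  have [s sP] := tbA _ e2; have [|y Fy] := @big_ultra s (eps / 2).
    by apply: filterS FA => z /sP.
  exists y; apply: filterS Fy => z /= zy; rewrite ball_absE absBC (le_lt_trans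
    zy)//.
  by rewrite ltr_pdivrMr// ltr_pMr// ltr1n.
have Fl : F --> lim F by apply: Ccomplete.
exists (lim F); split => //; apply: clA => B nB.
have /filter_ex[z []] : F (A `&` B) by apply: filterI => //; exact: Fl.
by exists z.
Qed.

Lemma compact_totally_boundedP A : compact A -> totally_bounded A.
Proof.
rewrite compact_cover => cA eps eps0.
have [|z Az|D _ AD] := cA C A (fun y => ball y eps).
- by move=> y _; exact: open_abs_ball.
- by exists z => //; exact: ballxx.
exists D => z /AD[y yD zy]; exists y; first exact: yD.
by move: zy; rewrite ball_absE absBC => /ltW.
Qed.

Lemma compact_sub_Delta A : compact A -> exists rho : R, A `<=` Delta rho.
Proof.
move=> /compact_totally_boundedP/(_ 1 ltr01)[s sP].
exists (1 + \sum_(y <- s) abs y) => z /sP[y ys zy]; rewrite /Delta /=.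
have S0 : 0 <= \sum_(y <- s) abs y by apply: sumr_ge0 => *; exact: abs_ge0.
rewrite -(subrK y z); apply: absD_le; first by rewrite (le_trans zy)// lerDl.
rewrite ler_wpDl// {zy S0 sP}; elim: s ys => // x s ih; rewrite inE big_cons.
have S0 : 0 <= \sum_(y <- s) abs y by apply: sumr_ge0 => *; exact: abs_ge0.
by move=> /predU1P[->|/ih h]; rewrite ?lerDl// (le_trans h)// lerDr abs_ge0.
Qed.

Lemma locally_compact_subsetP A :
  (forall rho : R, 0 < rho -> compact (A `&` Delta rho)) ->
  locally_compact_subset A.
Proof.
move=> cA x _; set x0 := set_val x; pose rho := abs x0 + 1.
have r0 : 0 < rho by rewrite ltr_wpDl ?abs_ge0.
pose K : set A := set_val @^-1` Delta rho.
exists K; last split.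
- rewrite /within /=; exists (set_val @^-1` ball x0 1); split => /=.
  + by exists (ball x0 1) => //; exact: open_abs_ball.
  + exact: ballxx.
  + move=> y; rewrite /= ball_absE => xy _; rewrite /K /Delta /= -[set_val
      y](subKr x0).
    by apply: absB_le; rewrite ?lerDl// (le_trans (ltW xy))// lerDr abs_ge0.
(* A filter on the subtype is pushed forward to [C]; its cluster point lies in [A] and so lifts
   back. *)
- move=> F FF FK; pose G := set_val @ F.
  have GA : G (A `&` Delta rho).
    apply: (@filterS _ F _ K) => // y Ky; split; last exact: Ky.
    exact: set_valP.
  have [y [[Ay yr] Gy]] := cA _ r0 G (fmap_proper_filter _ FF) GA.
  exists (SigSub (mem_set Ay)); split => //= U V FU.
  case=> W [[B oB <-] By BV].
  have [z [[u Uu <-] Bz]] : (set_val @` U) `&` B !=set0.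
    apply: Gy; last by apply: open_nbhs_nbhs; split.
    by apply: (@filterS _ F _ U) => // u Uu; exists u.
  by exists u; split => //; exact: BV.
- rewrite /K; apply: preimage_closed; last exact: closed_Delta.
  by move=> u _; exact: initial_continuous.
Qed.

End UltrametricTopology.

(** * Lexicographic maxima, comparison of powers, counting *)

Lemma ratr_lt (R : realType) (x y : rat) : (ratr x < ratr y :> R) = (x < y).
Proof. exact: ltr_rat. Qed.

Lemma exists_lexmax (T : eqType) (R S : realDomainType) (g : T ->
  R) (h : T -> S)
    (x0 : T) (s : seq T) : x0 \in s ->
  exists2 x, x \in s &
    forall y, y \in s -> g y < g x \/ (g y = g x /\ h y <= h x).
Proof.
elim: s x0 => [|x [|x1 s] ih] x0 //.
  by move=> _; exists x; rewrite ?mem_head// => y; rewrite inE => /eqP ->;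
    right.
move=> _; have [y ys yP] := ih x1 (mem_head _ _).
have [ltg|ltg|eqg] := ltgtP (g x) (g y).
- exists y; first by rewrite inE ys orbT.
  by move=> z; rewrite inE => /predU1P[->|/yP//]; left.
- exists x; first exact: mem_head.
  move=> z; rewrite inE => /predU1P[->|/yP]; first by right.
  by move=> [gz|[gz _]]; left; rewrite ?gz// (lt_trans gz).
- have [hxy|hxy] := leP (h x) (h y).
    exists y; first by rewrite inE ys orbT.
    by move=> z; rewrite inE => /predU1P[->|/yP//]; right.
  exists x; first exact: mem_head.
  move=> z; rewrite inE => /predU1P[->|/yP]; first by right.
  by rewrite eqg => -[?|[? hz]]; [left|right; rewrite (le_trans hz)// ltW].
Qed.

Lemma exists_expr_ge (R : realType) (x M : R) : 1 < x -> exists n, M <= x ^+ n.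
Proof.
move=> x1; have x10 : 0 < x - 1 by rewrite subr_gt0.
have bern n : 1 + (x - 1) *+ n <= x ^+ n.
  elim: n => [|n ih]; first by rewrite mulr0n addr0 expr0.
  rewrite exprS -[x in x * _](subrK 1) mulrDl mul1r mulrSr addrA addrC.
  by rewrite lerD// ler_peMr ?(ltW x10)// exprn_ege1// ltW.
exists (Num.bound `|M / (x - 1)|).
rewrite (le_trans _ (bern _))// ler_wpDl// -mulr_natl -ler_pdivrMr//.
by rewrite (le_trans (ler_norm _))// ltW// archi_boundP.
Qed.

(** A threshold uniform in j: the finitely many j with u_j > u_i / 2 each impose one, and for the
    others u_j < u_i already suffices once kappa >= 1. *)
Lemma powR_dominates (R : realType) (I : choiceType) (u v : I -> R) (i : I) :
  (forall j, 0 <= u j) -> 0 < u i -> finite_set [set j | u i / 2 < u j] ->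
  exists2 kappa0, 1 <= kappa0 & forall kappa, kappa0 <= kappa ->
    forall j, v j < v i -> u j * kappa `^ v j < u i * kappa `^ v i.
Proof.
move=> u0 ui0 fin.
have dom (s : seq I) : exists2 kappa0, 1 <= kappa0 &
    forall kappa, kappa0 <= kappa -> forall j, j \in s ->
      v j < v i -> u j * kappa `^ v j < u i * kappa `^ v i.
  elim: s => [|j s [k k1 ih]]; first by exists 1.
  have [vij|vij] := ltP (v j) (v i); last first.
    exists k => // kappa kk x; rewrite inE => /predU1P[->|/ih]; last exact.
    by rewrite ltNge vij.
  (* Solves c ^ (v_i - v_j) = u_j / u_i + 1; the added 1 makes the comparison strict and the base
     positive when u_j = 0. *)
  pose c := (u j / u i + 1) `^ (v i - v j)^-1.
  have A0 : 0 <= u j / u i by rewrite divr_ge0// ltW.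
  have A1 : 0 < u j / u i + 1 by rewrite ltr_wpDl.
  exists (Num.max k c); first by rewrite le_max k1.
  move=> kappa; rewrite ge_max => /andP[kk ck] x.
  rewrite inE => /predU1P[->{x} _|/ih]; last exact.
  have d0 : 0 < v i - v j by rewrite subr_gt0.
  have kappa0 : 0 < kappa by rewrite (lt_le_trans _ kk)// (lt_le_trans ltr01).
  rewrite -[v i in ltRHS](subrK (v j)) powRD;
    last by rewrite (gt_eqF kappa0) implybT.
  rewrite mulrA ltr_pM2r ?powR_gt0// mulrC -ltr_pdivrMr//.
  rewrite (@lt_le_trans _ _ (u j / u i + 1)) ?ltrDl//.
  have -> : u j / u i + 1 = c `^ (v i - v j).
    by rewrite -powRrM mulVf ?gt_eqF// powRr1// ltW.
  by apply: ge0_ler_powR; rewrite ?nnegrE ?powR_ge0// ltW.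
have [kappa0 k01 k0P] := dom (fset_set [set j | u i / 2 < u j]).
exists kappa0 => // kappa kk j vij; have [uj|uj] := leP (u j) (u i / 2);
  last first.
  by apply: k0P => //; rewrite in_fset_set// inE.
have k1 : 1 <= kappa by rewrite (le_trans k01).
have k0 : 0 < kappa by rewrite (lt_le_trans ltr01).
apply: (@lt_le_trans _ _ (u i * kappa `^ v j)).
  by rewrite ltr_pM2r ?powR_gt0// (le_lt_trans uj)// ltr_pdivrMr// ltr_pMr//
    ltr1n.
by rewrite ler_pM2l// ler_powR// ltW.
Qed.

Lemma sum_count_le (S T : eqType) (B : S -> pred T) (B0 : pred T) (F : seq S)
  (s : seq T) :
  uniq F ->
  (forall h h' x, h \in F -> h' \in F -> B h x -> B h' x -> h = h') ->
  (forall h x, h \in F -> B h x -> B0 x) ->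
  (\sum_(h <- F) count (B h) s <= count B0 s)%N.
Proof.
move=> uF disj sub; elim: s => [|x s ih]; first by rewrite big1.
rewrite /= big_split /= leq_add//.
have [[h hF hx]|no] := pselect (exists2 h, h \in F & B h x).
  rewrite (sub _ _ hF hx) (bigD1_seq h)//= hx big_seq_cond big1// =>
    h' /andP[h'F hh'].
  case: (boolP (B h' x)) => // h'x.
  by rewrite (disj _ _ _ h'F hF h'x hx) eqxx in hh'.
rewrite big_seq big1// => h hF; case: (boolP (B h x)) => // hx.
by exfalso; apply: no; exists h.
Qed.

Lemma abs_unbounded (R : realType) (C : nonarchClosedFieldType R) (x : C) (M :
  R) :
  1 < abs x -> exists z : C, M <= abs z.
Proof. by move=> /(exists_expr_ge M)[n]; exists (x ^+ n); rewrite absX. Qed.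

(** Bound and Lipschitz constant are proved together, since the Lipschitz step for P * X + c uses
    the bound on P. The constant is not sharp. *)
Lemma poly_lipschitz (R : realType) (C : nonarchClosedFieldType R) (P : {poly
  C})
    (rho : R) : 0 <= rho ->
  exists2 B, 0 < B & forall w v, abs w <= rho -> abs v <= rho ->
    abs P.[w] <= B /\ abs (P.[w] - P.[v]) <= B * abs (w - v).
Proof.
move=> rho0; elim/poly_ind: P => [|P c [B B0 ih]].
  by exists 1 => // w v _ _; rewrite !horner0 subrr abs0 ler01 mul1r abs_ge0.
exists (B * rho + B + abs c); first by rewrite ltr_pwDl ?abs_ge0// ltr_wpDl//
  mulr_ge0// ltW.
move=> w v wr vr; rewrite !hornerE; have [Pw Pwv] := ih _ _ wr vr.
have [Pv _] := ih _ _ vr vr.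
have Brho : 0 <= B * rho by rewrite mulr_ge0// ltW.
split.
  apply: absD_le; last by rewrite lerDr addr_ge0// ltW.
  by rewrite absM -addrA ler_wpDr ?addr_ge0 ?abs_ge0 ?ler_pM ?abs_ge0// ltW.
have -> : P.[w] * w + c - (P.[v] * v + c) = (P.[w] - P.[v]) * w + P.[v] * (w -
  v).
  by rewrite opprD addrACA subrr addr0 mulrBl mulrBr addrA subrK.
apply: absD_le.
  rewrite absM (@le_trans _ _ (B * abs (w - v) * rho))//.
    by rewrite ler_pM ?abs_ge0.
  by rewrite mulrAC ler_wpM2r ?abs_ge0// -addrA ler_wpDr// addr_ge0 ?abs_ge0//
    ltW.
rewrite absM ler_wpM2r ?abs_ge0// (le_trans Pv)// -addrA addrCA lerDl.
by rewrite addr_ge0 ?abs_ge0.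
Qed.

(** * Zeros of series with exponents in [expoE p] *)

Section Family.
Context {R : realType} {C : nonarchClosedFieldType R} (p : nat).
Hypotheses (Ccomplete : complete_space C) (p_pr : prime p) (pC : p \in [pchar
  C]).
Context (I : choiceType) (a : I -> C) (e : I -> rat).
Hypotheses (e_inj : injective e) (eE : forall i, expoE p (e i))
  (conv : forall z : C, tends_to_0 (fun i => a i * powE z (e i))).
Implicit Types (z w : C) (i j : I) (rho t eps : R) (J : {fset I}).

(** The abstract index type covers both kinds of series: [I] is [expoE p] for the first half of the
    theorem, and [int] with exponents q ^ n for the second. *)
Definition fsum z : C := usum (fun i => a i * powE z (e i)).

Definition coefsize rho i : R := abs (a i) * rho `^ ratr (e i).

(* [i] is the largest exponent at which the Gauss norm on [Delta rho] is
   attained. *)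
Definition dominant rho i := [/\ a i != 0,
  forall j, coefsize rho j <= coefsize rho i &
  forall j, e i < e j -> coefsize rho j < coefsize rho i].

Lemma re_ge0 i : 0 <= ratr (e i) :> R.
Proof. by rewrite ler0q (expoE_ge0 (eE i)). Qed.

Lemma coefsize_ge0 rho i : 0 <= coefsize rho i.
Proof. by rewrite mulr_ge0 ?abs_ge0 ?powR_ge0. Qed.

Lemma coefsize_gt0 rho i : 0 < rho -> a i != 0 -> 0 < coefsize rho i.
Proof. by move=> rho0 ai; rewrite mulr_gt0 ?abs_gt0 ?powR_gt0. Qed.

Lemma abs_term z i : abs (a i * powE z (e i)) = coefsize (abs z) i.
Proof. by rewrite absM (abs_powE p_pr pC). Qed.

Lemma le_coefsize rho rho' i : 0 <= rho -> rho <= rho' ->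
  coefsize rho i <= coefsize rho' i.
Proof.
move=> rho0 rr; rewrite ler_wpM2l ?abs_ge0// ge0_ler_powR ?re_ge0 ?nnegrE//.
exact: le_trans rr.
Qed.

(** Convergence is only known at points of [C], so a point of absolute value at least [rho] is
    needed; powers of an x with |x| > 1 supply it. *)
Lemma finite_coefsize rho eps : 0 <= rho -> 0 < eps ->
  finite_set [set i | eps < coefsize rho i].
Proof.
move=> rho0 eps0; have [[x /(abs_unbounded rho)[z zr]]|triv] :=
  pselect (exists x : C, 1 < abs x).
  apply: sub_finite_set (conv z eps0) => i /= /lt_le_trans; apply.
  by rewrite abs_term le_coefsize.
(* Here the absolute value is trivial: a nonzero coefficient has absolute value 1, and convergence
   at 1 leaves finitely many of them. *)
have le1 (x : C) : abs x <= 1 by rewrite leNgt; apply/negP => x1; apply: triv;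
  exists x.
have half0 : 0 < 1 / 2 :> R by rewrite divr_gt0.
apply: sub_finite_set (conv 1 half0) => i /= h.
rewrite abs_term /coefsize abs1 powR1 mulr1 (@lt_le_trans _ _ 1)//.
  by rewrite ltr_pdivrMr// mul1r ltr1n.
have ai : a i != 0.
  by apply: contraTN h => /eqP ai; rewrite /coefsize ai abs0 mul0r -leNgt ltW.
by rewrite -(@abs1 R C) -(mulfV ai) absM ler_piMr ?abs_ge0.
Qed.

Definition bigidx rho eps : {fset I} := fset_set [set i | eps < coefsize rho i].

Lemma mem_bigidx rho eps i : 0 <= rho -> 0 < eps -> eps < coefsize rho i ->
  i \in bigidx rho eps.
Proof. by move=> *; rewrite in_fset_set ?inE//; exact: finite_coefsize. Qed.

Lemma fsum_approx rho eps J z : 0 < eps -> abs z <= rho ->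
  (bigidx rho eps `<=` J)%fset ->
  abs (fsum z - \sum_(i <- J) a i * powE z (e i)) <= eps.
Proof.
move=> eps0 zr /fsubsetP big; apply: usum_approx => // i.
rewrite abs_term => h; apply: big; apply: mem_bigidx => //.
  by rewrite (le_trans _ zr) ?abs_ge0.
by rewrite (lt_le_trans h)// le_coefsize ?abs_ge0.
Qed.

(** Only finitely many terms exceed half the size of term [i0], so the maximum, with ties broken by
    the exponent, is taken over a finite set containing [i0]. *)
Lemma exists_dominant rho i0 : 0 < rho -> a i0 != 0 -> exists i, dominant rho i.
Proof.
move=> rho0 ai0; have c0 := coefsize_gt0 rho0 ai0.
have c20 : 0 < coefsize rho i0 / 2 by rewrite divr_gt0.
have c2c : coefsize rho i0 / 2 < coefsize rho i0.
  by rewrite ltr_pdivrMr// ltr_pMr// ltr1n.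
have i0b : i0 \in bigidx rho (coefsize rho i0 / 2) by rewrite mem_bigidx// ltW.
have [i ib iP] := exists_lexmax (coefsize rho) e i0b; exists i.
have ci : coefsize rho i0 <= coefsize rho i.
  by case: (iP _ i0b) => [/ltW//|[->]].
have small j : j \notin bigidx rho (coefsize rho i0 / 2) ->
  coefsize rho j < coefsize rho i.
  move=> jb; rewrite (le_lt_trans _ (lt_le_trans c2c ci))// leNgt.
  by apply: contra jb => ?; rewrite mem_bigidx// ltW.
split => [|j|j eij].
- apply/negP => /eqP ai; move: ci; rewrite leNgt; apply/negP/negPn.
  by rewrite {1}/coefsize ai abs0 mul0r.
- have [jb|/small/ltW//] := boolP (j \in bigidx rho (coefsize rho i0 / 2)).
  by case: (iP _ jb) => [/ltW//|[->]].
- have [jb|/small//] := boolP (j \in bigidx rho (coefsize rho i0 / 2)).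
  by case: (iP _ jb) => // -[_]; rewrite leNgt eij.
Qed.

Lemma dominant_large i rho0 : 0 < rho0 -> a i != 0 ->
  exists2 rho1, rho0 <= rho1 & forall rho, rho1 <= rho ->
    forall j, e j < e i -> coefsize rho j < coefsize rho i.
Proof.
move=> r0 ai; have c0 := coefsize_gt0 r0 ai.
have [|||k k1 kP] := @powR_dominates R I (coefsize rho0) (fun j =>
  ratr (e j)) i.
- by move=> j; exact: coefsize_ge0.
- by [].
- by apply: finite_coefsize; rewrite ?divr_gt0// ltW.
exists (k * rho0); first by rewrite ler_peMl// ltW.
move=> rho; rewrite -ler_pdivlMr// => krho j ej; have h := kP _ krho j.
have rE : rho0 * (rho / rho0) = rho by rewrite mulrC divfK// gt_eqF.
have rr0 : 0 <= rho / rho0 by rewrite (le_trans ler01)// (le_trans k1).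
by move: h; rewrite ratr_lt => /(_ ej); rewrite /coefsize -!mulrA -!powRM ?rE//
  ltW.
Qed.

(** Shrinking the radius to rho0 / kappa is the comparison for large kappa with the exponents
    negated. *)
Lemma dominant_small i rho0 : 0 < rho0 -> a i != 0 ->
  exists2 rho1, 0 < rho1 <= rho0 & forall rho, 0 < rho <= rho1 ->
    forall j, e i < e j -> coefsize rho j < coefsize rho i.
Proof.
move=> r0 ai; have c0 := coefsize_gt0 r0 ai.
have [|||k k1 kP] := @powR_dominates R I (coefsize rho0) (fun j =>
  - ratr (e j)) i.
- by move=> j; exact: coefsize_ge0.
- by [].
- by apply: finite_coefsize; rewrite ?divr_gt0// ltW.
have k0 : 0 < k by rewrite (lt_le_trans ltr01).
exists (rho0 / k); first by rewrite divr_gt0//= ler_pdivrMr// ler_peMr// ltW.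
move=> rho /andP[rho_gt0 krho] j ej.
have krho' : k <= rho0 / rho by rewrite ler_pdivlMr// mulrC -ler_pdivlMr.
have kk0 : 0 <= rho0 / rho by rewrite divr_ge0// ltW.
have kE x : (rho0 / rho) `^ (- x) = (rho / rho0) `^ x.
  by rewrite -mulN1r powRrM powR_inv1// invf_div.
have rE : rho0 * (rho / rho0) = rho by rewrite mulrC divfK// gt_eqF.
have := kP _ krho' j; rewrite ltrN2 ratr_lt => /(_ ej).
by rewrite !kE /coefsize -!mulrA -!powRM ?rE ?divr_ge0// ltW.
Qed.

(* The exponents of a finite sub-family become integers in the variable [z ^
   (1 / p ^ N)]. *)
Definition degree_at N i : nat := `|numq (e i * (p ^ N)%:R)|.

Definition integral_at N J := {in J, forall i,
  e i * (p ^ N)%:R = (degree_at N i)%:R}.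

Lemma exists_integral_at J : exists N, integral_at N J.
Proof.
have [|N NP] := @expoE_scale_seq p p_pr (map e J).
  by move=> x /mapP[i _ ->].
exists N => i iJ; have [d dE] := NP _ (map_f e iJ).
by rewrite /degree_at dE -[d%:R]/(d%:Z%:~R) numq_int.
Qed.

Lemma pX_gt0 N : 0 < (p ^ N)%:R :> R.
Proof. by rewrite ltr0n expn_gt0 prime_gt0. Qed.

Definition root_radius N rho : R := rho `^ (p ^ N)%:R^-1.

Lemma root_radiusK N rho : 0 <= rho -> root_radius N rho ^+ (p ^ N) = rho.
Proof.
move=> r0; rewrite -powR_mulrn ?powR_ge0// -powRrM mulVf ?powRr1//.
by rewrite gt_eqF// pX_gt0.
Qed.

Lemma root_radius_gt0 N rho : 0 < rho -> 0 < root_radius N rho.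
Proof. exact: powR_gt0. Qed.

Lemma root_radius_degree N J i rho : 0 <= rho -> integral_at N J -> i \in J ->
  root_radius N rho ^+ degree_at N i = rho `^ ratr (e i).
Proof.
move=> r0 NJ iJ; rewrite -powR_mulrn ?powR_ge0// -powRrM; congr (_ `^ _).
rewrite -(ratr_nat R (degree_at N i)) -NJ// rmorphM /= ratr_nat mulrCA mulVf
  ?mulr1//.
by rewrite gt_eqF// pX_gt0.
Qed.

Lemma le_root_radius N rho (x : C) : 0 <= rho ->
  (abs x <= root_radius N rho) = (abs (x ^+ (p ^ N)) <= rho).
Proof.
move=> r0; rewrite absX -[in RHS](root_radiusK N r0) ler_pXn2r ?nnegrE ?abs_ge0
  ?powR_ge0//.
by rewrite expn_gt0 prime_gt0.
Qed.

Lemma degree_at_lt N J i j : integral_at N J -> i \in J -> j \in J ->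
  (degree_at N i < degree_at N j)%N = (e i < e j).
Proof.
move=> NJ iJ jJ; rewrite -(ltr_nat rat) -!NJ// ltr_pM2r//.
by rewrite ltr0n expn_gt0 prime_gt0.
Qed.

Lemma degree_at_inj N J : integral_at N J -> {in J &, injective (degree_at N)}.
Proof.
move=> NJ i j iJ jJ ij; apply: e_inj; apply/eqP; case: ltgtP => //.
  by rewrite -(degree_at_lt NJ)// ij ltnn.
by rewrite -(degree_at_lt NJ)// ij ltnn.
Qed.

Definition trunc_poly N J : {poly C} := \sum_(i <- J) a i *: 'X^(degree_at N i).

Lemma horner_trunc_poly N J w : integral_at N J ->
  (trunc_poly N J).[w] = \sum_(i <- J) a i * powE (w ^+ (p ^ N)) (e i).
Proof.
move=> NJ; rewrite horner_sum; apply: eq_big_seq => i iJ.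
by rewrite !hornerE (powE_root p_pr pC erefl (NJ _ iJ)).
Qed.

Lemma coef_trunc_poly N J i : integral_at N J -> i \in J ->
  (trunc_poly N J)`_(degree_at N i) = a i.
Proof.
move=> NJ iJ; rewrite coef_sum (bigD1_seq i)//= coefZ coefXn eqxx mulr1.
rewrite big_seq_cond big1 ?addr0// => j /andP[jJ ji]; rewrite coefZ coefXn.
case: eqP => [ij|_]; last by rewrite mulr0.
by move: ji; rewrite (degree_at_inj NJ _ _ ij) ?eqxx.
Qed.

Lemma coef_trunc_poly0 N J n : (forall i, i \in J -> n <> degree_at N i) ->
  (trunc_poly N J)`_n = 0.
Proof.
move=> h; rewrite coef_sum big_seq_cond big1// => j /andP[jJ _].
by rewrite coefZ coefXn; case: eqP => [/(h _ jJ)//|]; rewrite mulr0.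
Qed.

Lemma weierstrass_index_trunc N J rho i : 0 < rho ->
  integral_at N J -> i \in J ->
  dominant rho i ->
  weierstrass_index (trunc_poly N J) (root_radius N rho) (degree_at N i).
Proof.
move=> r0 NJ iJ [ai le_i lt_i]; have c0 := coefsize_gt0 r0 ai.
have sz j : j \in J -> abs (trunc_poly N J)`_(degree_at N j) *
    root_radius N rho ^+ degree_at N j = coefsize rho j.
  by move=> jJ; rewrite coef_trunc_poly// (root_radius_degree _ NJ)// ltW.
split => n; rewrite sz//.
  have [[j jJ ->]|no] := pselect (exists2 j, j \in J & n = degree_at N j).
    by rewrite sz.
  rewrite coef_trunc_poly0 ?abs0 ?mul0r ?coefsize_ge0// => j jJ nj.
  by apply: no; exists j.
move=> nd; have [[j jJ nj]|no] := pselect (exists2 j,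
  j \in J & n = degree_at N j).
  by rewrite nj sz// lt_i// -(degree_at_lt NJ)// -nj.
rewrite coef_trunc_poly0 ?abs0 ?mul0r// => j jJ nj.
by apply: no; exists j.
Qed.

Lemma trunc_poly_roots N J i : integral_at N J -> i \in J -> a i != 0 ->
  exists (c : C) (s : seq C), c != 0 /\
    trunc_poly N J = c *: \prod_(x <- s) ('X - x%:P).
Proof.
move=> NJ iJ ai; have [s sE] := closed_field_poly_normal (trunc_poly N J).
exists (lead_coef (trunc_poly N J)), s; split => //.
rewrite lead_coef_eq0; apply: contra ai => /eqP P0.
by rewrite -(coef_trunc_poly NJ iJ) P0 coef0.
Qed.

(** Hides the auxiliary variable: d is p ^ N, and s lists the p ^ N-th powers of the roots of the
    truncation. One list serves all radii whose dominant index lies in [J], which lets root counts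
    at two radii be compared. *)
Lemma exists_trunc_roots J i0 : i0 \in J -> a i0 != 0 ->
  exists (d : nat) (s : seq C), [/\ (0 < d)%N,
    forall y, y \in s -> \sum_(i <- J) a i * powE y (e i) = 0,
    forall rho i, 0 < rho -> i \in J -> dominant rho i ->
      (count (fun y => abs y <= rho) s)%:R = e i * d%:R &
    forall rho i z t, 0 < rho -> i \in J -> dominant rho i -> 0 < e i ->
      abs z <= rho -> 0 <= t ->
      abs (\sum_(i <- J) a i * powE z (e i)) <= abs (a i) * t `^ ratr (e i) ->
      exists y, [/\ y \in s, abs y <= rho & abs (z - y) <= t]].
Proof.
move=> i0J ai0; have [N NJ] := exists_integral_at J.
have [c [s [c0 PE]]] := trunc_poly_roots NJ i0J ai0.
have d0 : (0 < p ^ N)%N by rewrite expn_gt0 prime_gt0.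
have cnt rho i : 0 < rho -> i \in J -> dominant rho i ->
    count (fun x => abs x <= root_radius N rho) s = degree_at N i.
  move=> r0 iJ dom; have [_ + _] := weierstrass_index_prod s c0
    (root_radius_gt0 N r0).
  rewrite -PE => /weierstrass_index_uniq; apply.
  exact: weierstrass_index_trunc.
exists (p ^ N)%N, (map (fun x => x ^+ (p ^ N)) s); split => //.
- move=> _ /mapP[x xs ->]; rewrite -horner_trunc_poly// PE hornerZ.
  by apply/eqP; rewrite mulf_eq0; apply/orP; right;
    rewrite -/(root _ x) root_prod_XsubC.
- move=> rho i r0 iJ dom; rewrite NJ// -(cnt _ _ r0 iJ dom) count_map.
  by congr (_ %:R); apply: eq_count => x /=; rewrite le_root_radius// ltW.
- move=> rho i z t r0 iJ dom ei zr t0 fz.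
  have [w wz] := exists_root z d0.
  have wr : abs w <= root_radius N rho by rewrite le_root_radius ?wz// ltW.
  have := @exists_close_root _ _ c s _ w (root_radius N t) c0 (root_radius_gt0
    N r0) wr.
  rewrite /= -PE (cnt _ _ r0 iJ dom) coef_trunc_poly// (root_radius_degree t0
    NJ iJ).
  rewrite horner_trunc_poly// wz powR_ge0 => /(_ _ isT fz)[|x [xs xr wx]].
    rewrite -(ltr_nat rat) -NJ// mulr_gt0// ltr0n//.
  exists (x ^+ (p ^ N)); split; first by apply/mapP; exists x.
    by rewrite -le_root_radius// ltW.
  by rewrite -wz -(expBpX p_pr pC) -le_root_radius.
Qed.

(** The truncation error is set to the bound belonging to t / 2: small enough to preserve the
    hypothesis at t, and at an exact root of the truncation it is all that is left of [fsum]. *)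
Lemma exists_root_near rho i z t : 0 < rho -> dominant rho i -> 0 < e i ->
  abs z <= rho -> 0 < t -> abs (fsum z) <= abs (a i) * t `^ ratr (e i) ->
  exists y, [/\ abs y <= rho, abs (z - y) <= t &
    abs (fsum y) <= abs (a i) * (t / 2) `^ ratr (e i)].
Proof.
move=> r0 dom ei zr t0 fz; have [ai _ _] := dom.
have t20 : 0 < t / 2 by rewrite divr_gt0.
set eps := abs (a i) * (t / 2) `^ ratr (e i).
have eps0 : 0 < eps by rewrite mulr_gt0 ?abs_gt0 ?powR_gt0.
pose J := (i |` bigidx rho eps)%fset.
have iJ : i \in J by rewrite fset1U1.
have bJ : (bigidx rho eps `<=` J)%fset by rewrite fsubsetU1.
have [d [s [_ s0 _ sP]]] := exists_trunc_roots iJ ai.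
have [|y [ys yr zy]] := sP rho i z t r0 iJ dom ei zr (ltW t0).
  have -> : \sum_(i <- J) a i * powE z (e i) =
      fsum z - (fsum z - \sum_(i <- J) a i * powE z (e i)) by rewrite subKr.
  apply: absB_le => //; rewrite (le_trans (fsum_approx eps0 zr bJ))//.
  rewrite ler_wpM2l ?abs_ge0// ge0_ler_powR ?re_ge0 ?nnegrE ?ltW//.
  by rewrite ltr_pdivrMr// ltr_pMr// ltr1n.
exists y; split => //.
by have := fsum_approx eps0 yr bJ; rewrite s0// subr0.
Qed.

(** Up to eps the series is a polynomial in w = z ^ (1 / p ^ N), hence Lipschitz in w; the modulus
    for z is the p ^ N-th power of the one for w. *)
Lemma fsum_unif_continuous rho eps : 0 < rho -> 0 < eps ->
  exists2 delta, 0 < delta & forall x y, abs x <= rho -> abs y <= rho ->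
    abs (x - y) <= delta -> abs (fsum x - fsum y) <= eps.
Proof.
move=> r0 eps0; set J := bigidx rho eps.
have [N NJ] := exists_integral_at J.
have [B B0 BP] := poly_lipschitz (trunc_poly N J) (powR_ge0 rho (p ^ N)%:R^-1).
have d0 : (0 < p ^ N)%N by rewrite expn_gt0 prime_gt0.
exists ((eps / B) ^+ (p ^ N)); first by rewrite exprn_gt0// divr_gt0.
move=> x y xr yr xy; have [w wx] := exists_root x d0;
  have [v vy] := exists_root y d0.
have wr : abs w <= root_radius N rho by rewrite le_root_radius ?wx// ltW.
have vr : abs v <= root_radius N rho by rewrite le_root_radius ?vy// ltW.
have [_ Pwv] := BP _ _ wr vr.
apply: (absB_trans (fsum_approx eps0 xr (fsubset_refl _))).
rewrite absBC; apply: (absB_trans (fsum_approx eps0 yr (fsubset_refl _))).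
rewrite absBC -wx -vy -!horner_trunc_poly// (le_trans Pwv)//.
have eB0 : 0 <= eps / B by rewrite divr_ge0// ltW.
rewrite mulrC -ler_pdivlMr// -(@ler_pXn2r _ (p ^ N)) ?nnegrE ?abs_ge0//.
by rewrite -absX (expBpX p_pr pC) wx vy.
Qed.

Lemma exists_half_lt (t eps : R) : 0 < t -> 0 < eps ->
  exists n, t / 2 ^+ n < eps.
Proof.
move=> t0 eps0; have [|n nP] := @exists_expr_ge R 2 (t / eps + 1);
  first by rewrite ltr1n.
exists n; rewrite ltr_pdivrMr ?exprn_gt0// -ltr_pdivrMl// mulrC.
by rewrite (lt_le_trans _ nP)// ltrDl.
Qed.

Lemma seq_limit (u : nat -> C) (t : R) : 0 < t ->
  (forall n, abs (u n - u n.+1) <= t / 2 ^+ n) ->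
  exists y, forall n, abs (u n - y) <= t / 2 ^+ n.
Proof.
move=> t0 ut.
have step n k : abs (u n - u (n + k)%N) <= t / 2 ^+ n.
  elim: k => [|k ih]; first by rewrite addn0 subrr abs0 divr_ge0 ?exprn_ge0//
    ltW.
  apply: (absB_trans ih); rewrite addnS (le_trans (ut _))//.
  rewrite ler_pM2l// lef_pV2 ?posrE ?exprn_gt0// exprD ler_peMr ?exprn_ge0//.
  by rewrite exprn_ege1// ler1n.
have stepm n m : (n <= m)%N -> abs (u n - u m) <= t / 2 ^+ n.
  by move=> nm; rewrite -(subnKC nm).
have : cvg (u @ \oo).
  apply: Ccomplete; apply: cauchy_exP => eps eps0.
  have [n neps] := exists_half_lt t0 eps0; exists (u n).
  by exists n => // m nm /=; rewrite ball_absE (le_lt_trans (stepm _ _ nm)).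
set y := lim _ => uy; exists y => n.
have tn : 0 < t / 2 ^+ n by rewrite divr_gt0 ?exprn_gt0.
have [m _ my] := uy _ (nbhsx_ballx y _ tn).
have := my (maxn n m) (leq_maxr _ _); rewrite /= ball_absE absBC => /ltW.
exact: absB_trans (stepm _ _ (leq_maxl _ _)).
Qed.

(* A root of one truncation is an approximate root of a finer one, hence
   close to one of its roots; the resulting sequence converges to a zero. *)
Lemma exists_zero_near rho i z t : 0 < rho -> dominant rho i -> 0 < e i ->
  abs z <= rho -> 0 < t -> abs (fsum z) <= abs (a i) * t `^ ratr (e i) ->
  exists y, [/\ abs y <= rho, abs (z - y) <= t & fsum y = 0].
Proof.
move=> r0 dom ei zr t0 fz.
pose Q n x := abs x <= rho /\ abs (fsum x) <= abs (a i) * (t / 2 ^+ n) `^ ratr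
  (e i).
have /choice[g gP] : forall nx : nat * C, exists y, Q nx.1 nx.2 ->
    Q nx.1.+1 y /\ abs (nx.2 - y) <= t / 2 ^+ nx.1.
  (* The default 0 is never reached, since the sequence built below satisfies [Q] at every stage. *)
  move=> [n x] /=; have [Qx|nQ] := pselect (Q n x); last by exists 0.
  have [xr fx] := Qx; have tn : 0 < t / 2 ^+ n by rewrite divr_gt0 ?exprn_gt0.
  have [y [yr xy fy]] := exists_root_near r0 dom ei xr tn fx.
  by exists y => _; split => //; split => //; rewrite exprSr invfM mulrA.
pose u := fix u n := if n is m.+1 then g (m, u m) else z.
have uQ n : Q n (u n).
  elim: n => [|n ih]; first by rewrite /Q expr0 divr1.
  by have [] := gP (n, u n) ih.
have [y yP] : exists y, forall n, abs (u n - y) <= t / 2 ^+ n.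
  by apply: seq_limit => // n; have [] := gP (n, u n) (uQ n).
have zy : abs (z - y) <= t by have := yP 0%N; rewrite /= expr0 divr1.
have yr : abs y <= rho.
  have [n nr] := exists_half_lt t0 r0.
  rewrite -[y](subKr (u n)); apply: absB_le; first exact: (uQ n).1.
  by rewrite (le_trans (yP n))// ltW.
exists y; split => //; apply: abs_le0_eq => eps eps0.
have [delta delta0 dP] := fsum_unif_continuous r0 eps0.
have ai : 0 < abs (a i) by have [? _ _] := dom; rewrite abs_gt0.
have re0 : 0 < ratr (e i) :> R by rewrite ltr0q.
have s0 : 0 < (eps / abs (a i)) `^ (ratr (e i))^-1 by rewrite powR_gt0//
  divr_gt0.
(* Within [delta] the values at u_n and at the limit differ by at most eps; below the second bound
   the value at u_n is itself at most eps. *)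
have m0 : 0 < Num.min delta ((eps / abs (a i)) `^ (ratr (e i))^-1).
  by rewrite lt_min delta0.
have [n] := exists_half_lt t0 m0; rewrite lt_min => /andP[nd ns].
rewrite -[fsum y](subKr (fsum (u n))); apply: absB_le.
  rewrite (le_trans (uQ n).2)// mulrC -ler_pdivlMr//.
  rewrite (@le_trans _ _ (((eps / abs (a i)) `^ (ratr (e i))^-1) `^ ratr (e
    i)))//.
    apply: ge0_ler_powR; rewrite ?nnegrE ?powR_ge0// ?(ltW re0)// ?(ltW ns)//.
    by rewrite divr_ge0 ?exprn_ge0// ltW.
  by rewrite -powRrM mulVf ?gt_eqF// powRr1// divr_ge0// ltW.
by apply: dP => //; [exact: (uQ n).1|rewrite (le_trans (yP n))// ltW].
Qed.

(** The case where a 1 / m-th root makes no sense: the truncation has index 0, so it has no root in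
    the disc and constant absolute value |a_i| there, twice the truncation error. *)
Lemma dominant0_fsum_neq0 rho i z : 0 < rho -> dominant rho i -> e i = 0 ->
  abs z <= rho -> fsum z != 0.
Proof.
move=> r0 dom ei0 zr; have [ai _ _] := dom.
have ai0 : 0 < abs (a i) by rewrite abs_gt0.
have eps0 : 0 < abs (a i) / 2 by rewrite divr_gt0.
pose J := (i |` bigidx rho (abs (a i) / 2))%fset.
have iJ : i \in J by rewrite fset1U1.
have [N NJ] := exists_integral_at J.
have [c [s [c0 PE]]] := trunc_poly_roots NJ iJ ai.
have [w wz] : exists w, w ^+ (p ^ N) = z.
  by apply: exists_root; rewrite expn_gt0 prime_gt0.
have wr : abs w <= root_radius N rho by rewrite le_root_radius ?wz// ltW.
have di : degree_at N i = 0%N by rewrite /degree_at ei0 mul0r.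
have cnt : count (fun x => abs x <= root_radius N rho) s = 0%N.
  have [_ + _] := weierstrass_index_prod s c0 (root_radius_gt0 N r0).
  rewrite -PE => /weierstrass_index_uniq; apply.
  by rewrite -[0%N]di; exact: weierstrass_index_trunc.
have := abs_horner_roots s c0 (root_radius_gt0 N r0) wr.
rewrite /= -PE cnt -[0%N]di coef_trunc_poly// -big_filter.
have -> : [seq x <- s | abs x <= root_radius N rho] = [::].
  by apply/nilP; rewrite /nilp size_filter cnt.
rewrite big_nil mulr1 horner_trunc_poly// wz => fJ.
apply/negP => /eqP fz; have := fsum_approx eps0 zr (fsubsetU1 i _ : _ `<=`
  J)%fset.
by rewrite fz sub0r absN fJ leNgt ltr_pdivrMr// ltr_pMr// ltr1n.
Qed.

(** The roots of one truncation serve as centers, because every zero of the series is an approximate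
    zero of it. *)
Lemma zeros_totally_bounded rho eps i0 : 0 < rho -> 0 < eps -> a i0 != 0 ->
  exists s : seq C, forall z, abs z <= rho -> fsum z = 0 ->
    exists2 y, y \in s & abs (z - y) <= eps.
Proof.
move=> r0 eps0 ai0; have [i dom] := exists_dominant r0 ai0.
have [ei0|ei0] := eqVneq (e i) 0.
  exists [::] => z zr fz; have := dominant0_fsum_neq0 r0 dom ei0 zr.
  by rewrite fz eqxx.
have ei : 0 < e i by rewrite lt_neqAle eq_sym ei0 (expoE_ge0 (eE i)).
have [ai _ _] := dom.
set t := abs (a i) * eps `^ ratr (e i).
have t0 : 0 < t by rewrite mulr_gt0 ?abs_gt0 ?powR_gt0.
pose J := (i |` bigidx rho t)%fset.
have iJ : i \in J by rewrite fset1U1.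
have [d [s [_ _ _ sP]]] := exists_trunc_roots iJ ai.
exists s => z zr fz; have [|y [ys _ zy]] := sP rho i z eps r0 iJ dom ei zr (ltW
  eps0).
  by have := fsum_approx t0 zr (fsubsetU1 i _ : _ `<=` J)%fset;
    rewrite fz sub0r absN.
by exists y.
Qed.

(** A truncation containing both indices has more roots in the larger disc, hence a root y in the
    annulus. A true zero lies within rho / 2 < |y| of y and therefore has the absolute value of
    y. *)
Lemma exists_zero_between rho rho' i i' : 0 < rho -> rho <= rho' ->
  dominant rho i -> dominant rho' i' -> e i < e i' ->
  exists2 z, fsum z = 0 & rho < abs z <= rho'.
Proof.
move=> r0 rr dom dom' ii'; have r0' := lt_le_trans r0 rr.
have ei' : 0 < e i' by rewrite (le_lt_trans _ ii')// (expoE_ge0 (eE i)).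
have [ai' _ _] := dom'.
have rho20 : 0 < rho / 2 by rewrite divr_gt0.
have r2r : rho / 2 < rho by rewrite ltr_pdivrMr// ltr_pMr// ltr1n.
set eps := abs (a i') * (rho / 2) `^ ratr (e i').
have eps0 : 0 < eps by rewrite mulr_gt0 ?abs_gt0 ?powR_gt0.
pose J := (i |` (i' |` bigidx rho' eps))%fset.
have iJ : i \in J by rewrite fset1U1.
have i'J : i' \in J by rewrite !inE eqxx orbT.
have bJ : (bigidx rho' eps `<=` J)%fset.
  by rewrite (fsubset_trans (fsubsetU1 i' _))// fsubsetU1.
have [d [s [d0 s0 cnt _]]] := exists_trunc_roots i'J ai'.
have [y ys /andP[yr yr']] : exists2 y, y \in s & rho < abs y <= rho'.
  apply: contrapT => no.
  have : (count (fun y => abs y <= rho') s)%:R <= (count (fun y =>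
    abs y <= rho) s)%:R :> rat.
    rewrite ler_nat (@eq_in_count _ _ (fun y =>
      (abs y <= rho') && (abs y <= rho))).
      by apply: sub_count => y /andP[].
    move=> y ys; apply/esym/andb_idr => yr'; rewrite leNgt; apply/negP => yr.
    by apply: no; exists y; rewrite ?yr.
  rewrite (cnt _ _ r0 iJ dom) (cnt _ _ r0' i'J dom') leNgt ltr_pM2r ?ii'//.
  by rewrite ltr0n.
have fy : abs (fsum y) <= eps by have := fsum_approx eps0 yr' bJ;
  rewrite s0// subr0.
have [z [zr zy fz]] := exists_zero_near r0' dom' ei' yr' rho20 fy.
exists z => //; rewrite zr andbT -[z](subKr y) absBl//.
by rewrite (le_lt_trans zy)// (lt_trans r2r).
Qed.

Definition zeros : set C := fsum @^-1` [set 0].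

Lemma closed_zeros : closed zeros.
Proof.
apply: closed_absP => z zP; apply: abs_le0_eq => eps eps0.
have r0 : 0 < abs z + 1 by rewrite ltr_wpDl ?abs_ge0.
have [delta delta0 dP] :=
  fsum_unif_continuous r0 eps0.
have m0 : 0 < Num.min delta 1 by rewrite lt_min delta0 ltr01.
have [x Zx] := zP _ m0; rewrite lt_min => /andP[xd x1].
have := dP z x; rewrite [fsum x]Zx subr0; apply; last exact: ltW.
  by rewrite lerDl.
by rewrite -[x](subKr z) absB_le ?lerDl// (le_trans (ltW x1))// lerDr abs_ge0.
Qed.

Lemma totally_bounded_zeros rho i0 : 0 < rho -> a i0 != 0 ->
  totally_bounded (zeros `&` Delta rho).
Proof.
move=> r0 ai0 eps eps0.
have [s sP] := zeros_totally_bounded r0 eps0 ai0.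
by exists s => z [Zz zr]; exact: sP.
Qed.

Lemma compact_zeros_Delta rho i0 : 0 < rho -> a i0 != 0 ->
  compact (zeros `&` Delta rho).
Proof.
move=> r0 ai0; apply: compact_totally_bounded => //.
  by apply: closedI; [exact: closed_zeros|exact: closed_Delta].
exact: totally_bounded_zeros ai0.
Qed.

Lemma strictly_dominant_fsum_neq0 z i : z != 0 -> a i != 0 ->
  (forall j, j != i -> coefsize (abs z) j < coefsize (abs z) i) ->
  fsum z != 0.
Proof.
move=> z0 ai dom; have c0 : 0 < coefsize (abs z) i.
  by apply: coefsize_gt0; rewrite ?abs_gt0.
set c := coefsize (abs z) i in dom c0.
have c20 : 0 < c / 2 by rewrite divr_gt0.
pose J := (i |` bigidx (abs z) (c / 2))%fset.
have iJ : i \in J by rewrite fset1U1.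
have := fsum_approx c20 (lexx (abs z))
  (fsubsetU1 i _ : _ `<=` J)%fset.
rewrite (bigD1_seq i)//=; set S := \sum_(_ <- _ | _) _ => h.
have Sc : abs S < c.
  rewrite /S; elim/big_ind: _ => [|x y xc yc|j ji]; first by rewrite abs0.
    exact: absD_lt.
  by rewrite abs_term dom.
have ic : abs (a i * powE z (e i)) = c by rewrite abs_term.
apply/negP => /eqP fz; move: h; rewrite fz sub0r absN absDl ?ic//.
by rewrite leNgt ltr_pdivrMr// ltr_pMr// ltr1n.
Qed.

(** Without a largest exponent the dominant one keeps growing with the radius, and each increase
    produces a zero farther out. A largest one strictly dominates all other terms far from 0, so no
    zeros lie there. *)
Lemma compact_zerosP i0 : a i0 != 0 ->
  compact zeros <-> exists i, a i != 0 /\ forall j, a j != 0 -> e j <= e i.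
Proof.
move=> ai0; split.
- move=> /compact_sub_Delta[rho Zr]; pose rho1 := Num.max rho 1.
  have r10 : 0 < rho1 by rewrite lt_max ltr01 orbT.
  have [i dom] := exists_dominant r10 ai0.
  apply: contrapT => no; have [ai _ _] := dom.
  have [j aj ij] : exists2 j, a j != 0 & e i < e j.
    apply: contrapT => noj; apply: no; exists i; split => // j aj.
    by rewrite leNgt; apply/negP => ij; apply: noj; exists j.
  have [rho2 r12 r2P] := dominant_large r10 aj.
  have r20 := lt_le_trans r10 r12.
  have [i2 dom2] := exists_dominant r20 ai0.
  have ii2 : e i < e i2.
    rewrite (lt_le_trans ij)// leNgt; apply/negP => /(r2P _ (lexx _)).
    by have [_ /(_ j)] := dom2; rewrite leNgt => /negbTE ->.
  have [z Zz /andP[zr _]] :=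
    exists_zero_between r10 r12 dom dom2 ii2.
  have := Zr z Zz; rewrite /Delta /= leNgt (le_lt_trans _ zr)//.
  by rewrite le_max lexx.
- move=> [M [aM maxM]].
  have [rho1 r11 r1P] := dominant_large ltr01 aM.
  have r10 := lt_le_trans ltr01 r11.
  have -> : zeros = zeros `&` Delta rho1; last exact: compact_zeros_Delta aM.
  apply/seteqP; split => [z Zz|z []//]; split => //; rewrite /Delta /= leNgt.
  apply/negP => zr; have z0 : z != 0 by rewrite -abs_gt0 (lt_trans r10).
  suff dom j : j != M -> coefsize (abs z) j < coefsize (abs z) M.
    by have := strictly_dominant_fsum_neq0 z0 aM dom; rewrite [fsum z]Zz eqxx.
  move=> jM; have [aj|aj] := eqVneq (a j) 0.
    by rewrite {1}/coefsize aj abs0 mul0r coefsize_gt0// abs_gt0.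
  apply: r1P; first exact: ltW.
  by rewrite lt_neqAle maxM// andbT; apply: contra jM => /eqP/e_inj ->.
Qed.

(** * Additive series: exponents that are powers of p *)

Section Additive.
Hypothesis e_pow : forall i, exists m : int, e i = p%:R ^ m.

Lemma powED (x y : C) i : powE (x + y) (e i) = powE x (e i) + powE y (e i).
Proof.
have p0 : p%:R != 0 :> rat by rewrite pnatr_eq0 -lt0n prime_gt0.
have [[m|m] ->] := e_pow i.
  have E (z : C) : powE z (p%:R ^ m) = z ^+ (p ^ m).
    by apply: (@powE_root _ _ _ p_pr pC z z _ 0%N);
      rewrite ?expr1// expn0 mulr1 natrX.
  by rewrite !E (expDpX p_pr pC).
have E (w : C) : powE (w ^+ (p ^ m.+1)) (p%:R ^ Negz m) = w.
  rewrite (@powE_root _ _ _ p_pr pC _ w _ m.+1 1) ?expr1//.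
  by rewrite NegzE -exprnN natrX mulVf ?expf_neq0.
have pm0 : (0 < p ^ m.+1)%N by rewrite expn_gt0 prime_gt0.
have [w <-] := exists_root x pm0; have [v <-] := exists_root y pm0.
by rewrite -(expDpX p_pr pC) !E.
Qed.

Lemma fsumD x y : fsum (x + y) = fsum x + fsum y.
Proof.
apply/eqP; rewrite -subr_eq0; apply/eqP; apply: abs_le0_eq => eps eps0.
pose rho := Num.max (abs x) (abs y).
pose f z := \sum_(i <- bigidx rho eps) a i * powE z (e i).
have fP z : abs z <= rho -> abs (fsum z - f z) <= eps.
  by move=> zr; exact: (fsum_approx eps0 zr (fsubset_refl _)).
have xr : abs x <= rho by rewrite le_max lexx.
have yr : abs y <= rho by rewrite le_max lexx orbT.
have fD : f (x + y) = f x + f y.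
  by rewrite -big_split; apply: eq_bigr => i _; rewrite /= powED mulrDr.
have -> : fsum (x + y) - (fsum x + fsum y) =
    (fsum (x + y) - f (x + y)) - ((fsum x - f x) + (fsum y - f y)).
  by rewrite fD addrACA -opprD opprB addrA subrK.
by apply: absB_le; [exact/fP/absD_le|apply: absD_le; exact: fP].
Qed.

Lemma fsum0 : fsum 0 = 0.
Proof. by apply: (addrI (fsum 0)); rewrite -fsumD !addr0. Qed.

Lemma fsumN x : fsum (- x) = - fsum x.
Proof. by apply/eqP; rewrite -addr_eq0 -fsumD addNr fsum0. Qed.

Lemma fsumB x y : fsum (x - y) = fsum x - fsum y.
Proof. by rewrite fsumD fsumN. Qed.

Lemma e_gt0 i : 0 < e i.
Proof. by have [m ->] := e_pow i; rewrite exprz_gt0// ltr0n prime_gt0. Qed.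

(** For a negative power of p, integrality makes the degree a divisor of p ^ N, hence again a power
    of p. *)
Lemma degree_at_pX N J i : integral_at N J -> i \in J ->
  exists n, degree_at N i = (p ^ n)%N.
Proof.
move=> NJ iJ; have := NJ _ iJ; set d := degree_at N i; have [m ->] := e_pow i.
have p0 : p%:R != 0 :> rat by rewrite pnatr_eq0 -lt0n prime_gt0.
case: m => m.
  by rewrite -[p%:R ^ m]/(p%:R ^+ m) -natrX -natrM -expnD => /eqP;
    rewrite eqr_nat => /eqP <-; exists (m + N)%N.
rewrite NegzE -exprnN -natrX => NE.
have pm0 : (p ^ m.+1)%:R != 0 :> rat by rewrite natrX expf_neq0.
have /eqP : (p ^ N)%:R = (p ^ m.+1 * d)%:R :> rat by rewrite natrM -NE mulVKf.
rewrite eqr_nat => /eqP pN.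
have /(dvdn_pfactor _ _ p_pr)[t _ ->] : (d %| p ^ N)%N by rewrite pN dvdn_mull.
by exists t.
Qed.

(** All degrees are powers of p, so each monomial is additive in characteristic p. *)
Lemma trunc_poly_comp_XaddC N J w : integral_at N J ->
  trunc_poly N J \Po ('X + w%:P) = trunc_poly N J + (trunc_poly N J).[w]%:P.
Proof.
move=> NJ; rewrite /trunc_poly horner_sum [X in _ = _ + X]rmorph_sum -big_split.
rewrite [LHS]rmorph_sum /=.
apply: eq_big_seq => i iJ; have [t ->] := degree_at_pX NJ iJ.
rewrite comp_polyZ comp_Xn_poly exprDn_pchar; last first.
  by rewrite pnatX pnatE// (rmorph_pchar (polyC : {rmorphism C ->
    {poly C}}) pC).
by rewrite scalerDr !hornerE -polyC_exp polyCM mul_polyC.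
Qed.

(** A zero h of the series is only an approximate zero of the truncation P, so translating P by h ^
    (1 / p ^ N) adds a constant below the peak, which leaves the index unchanged. Around each h
    there are thus as many roots as around 0; these groups are disjoint and all lie in the disc of
    radius r. *)
Lemma separated_zeros_le r rho i i' (F : seq C) : 0 < rho -> rho <= r ->
  dominant r i -> dominant rho i' -> uniq F ->
  (forall h, h \in F -> abs h <= r /\ fsum h = 0) ->
  (forall h h', h \in F -> h' \in F -> h != h' -> rho < abs (h - h')) ->
  (size F)%:R * e i' <= e i.
Proof.
move=> rho0 rhor dom dom' uF F0 sepF; have r0 := lt_le_trans rho0 rhor.
have [ai _ _] := dom; have [ai' _ _] := dom'.
have c0' := coefsize_gt0 rho0 ai'.
have eps0 : 0 < coefsize rho i' / 2 by rewrite divr_gt0.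
have epsc : coefsize rho i' / 2 < coefsize rho i' by rewrite ltr_pdivrMr//
  ltr_pMr// ltr1n.
set eps := coefsize rho i' / 2 in eps0 epsc.
pose J := (i |` (i' |` bigidx r eps))%fset.
have iJ : i \in J by rewrite fset1U1.
have i'J : i' \in J by rewrite !inE eqxx orbT.
have bJ : (bigidx r eps `<=` J)%fset.
  by rewrite (fsubset_trans (fsubsetU1 i' _))// fsubsetU1.
have [N NJ] := exists_integral_at J.
have [c [s [c0 PE]]] := trunc_poly_roots NJ iJ ai.
have d0 : (0 < p ^ N)%N by rewrite expn_gt0 prime_gt0.
have /choice[wf wfE] : forall h, exists w : C, w ^+ (p ^ N) = h.
  by move=> h; exact: exists_root.
have cnt : count (fun x => abs x <= root_radius N r) s = degree_at N i.
  have [_ + _] := weierstrass_index_prod s c0 (root_radius_gt0 N r0).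
  rewrite -PE => /weierstrass_index_uniq; apply; exact: weierstrass_index_trunc.
have cnth h : h \in F ->
    count (fun x => abs (x - wf h) <= root_radius N rho) s = degree_at N i'.
  move=> hF; have [hr fh] := F0 _ hF.
  have [_ + _] := weierstrass_index_prod (map (fun x =>
    x - wf h) s) c0 (root_radius_gt0 N rho0).
  have <- : trunc_poly N J + (trunc_poly N J).[wf h]%:P =
      c *: \prod_(x <- [seq x - wf h | x <- s]) ('X - x%:P).
    rewrite -trunc_poly_comp_XaddC// {1}PE comp_polyZ rmorph_prod big_map.
    congr (_ *: _); apply: eq_bigr => x _.
    by rewrite /= comp_polyB comp_polyX comp_polyC polyCB opprB addrA addrAC.
  rewrite count_map => /weierstrass_index_uniq; apply.
  apply: weierstrass_indexDC; last exact: weierstrass_index_trunc.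
    by rewrite -(ltr_nat rat) -NJ// mulr_gt0 ?e_gt0// ltr0n.
  rewrite coef_trunc_poly// (root_radius_degree (ltW rho0) NJ i'J)
    horner_trunc_poly// wfE.
  apply: le_lt_trans epsc; have := fsum_approx eps0 hr bJ.
  by rewrite fh sub0r absN.
have le : (size F * degree_at N i' <= degree_at N i)%N.
  rewrite -cnt mulnC -iter_addn_0 -count_predT -big_const_seq.
  rewrite -(eq_big_seq _ cnth); apply: sum_count_le => //.
  - move=> h h' x hF h'F xh xh'; apply/eqP; apply/negPn/negP =>
      /(sepF _ _ hF h'F).
    rewrite ltNge -[h]wfE -[h']wfE -(expBpX p_pr pC) -le_root_radius ?(ltW
      rho0)//.
    by rewrite (absB_trans (y := x))// absBC.
  - move=> h x hF; rewrite !le_root_radius ?(ltW rho0) ?(ltW r0)// (expBpX p_pr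
      pC) wfE => xh.
    by rewrite -(subrK h (x ^+ _)) absD_le ?(F0 _ hF).1// (le_trans xh).
by move: le; rewrite -(ler_nat rat) natrM -!NJ// mulrA ler_pM2r ?ltr0n.
Qed.

(** Terms at most eps at radius 1 stay so below it; the finitely many others tend to 0 because their
    exponents are positive. *)
Lemma coefsize_small eps : 0 < eps ->
  exists2 rho0, 0 < rho0 & forall rho i, 0 <= rho <= rho0 ->
    coefsize rho i <= eps.
Proof.
move=> eps0.
have small (s : seq I) : exists2 rho0, 0 < rho0 <= 1 &
    forall rho i, 0 <= rho <= rho0 -> i \in s -> coefsize rho i <= eps.
  elim: s => [|i s [r1 /andP[r10 r11] ih]]; first by exists 1;
    rewrite ?ltr01 ?lexx.
  have re0 : 0 < ratr (e i) :> R by rewrite ltr0q e_gt0.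
  have A0 : 0 < abs (a i) + 1 by rewrite ltr_wpDl ?abs_ge0.
  have E0 : 0 < eps / (abs (a i) + 1) by rewrite divr_gt0.
  pose c := (eps / (abs (a i) + 1)) `^ (ratr (e i))^-1.
  have c0 : 0 < c by rewrite powR_gt0.
  exists (Num.min r1 c); first by rewrite lt_min r10 c0 ge_min r11.
  move=> rho j; rewrite le_min => /and3P[rho0 rho1 rhoc];
    rewrite inE => /predU1P[->|]; last first.
    by apply: ih; rewrite rho0.
  apply: (@le_trans _ _ (abs (a i) * c `^ ratr (e i))).
    rewrite ler_wpM2l ?abs_ge0// ge0_ler_powR ?nnegrE// ?(ltW re0)// ltW//.
  rewrite -powRrM mulVf ?gt_eqF// powRr1 ?(ltW E0)// mulrA ler_pdivrMr// mulrC.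
  by rewrite ler_pM2l// lerDl.
have [rho0 /andP[r00 r01] rP] := small (bigidx 1 eps).
exists rho0 => // rho i /andP[rho_ge0 rhor]; have [ib|ib] :=
  boolP (i \in bigidx 1 eps).
  by apply: rP => //; rewrite rho_ge0.
rewrite (@le_trans _ _ (coefsize 1 i))// ?le_coefsize// ?(le_trans rhor)//.
by rewrite leNgt; apply: contra ib => h; rewrite mem_bigidx.
Qed.

(* The Gauss norm of an additive series tends to 0 with the radius, and its
   logarithmic derivative is the dominant exponent. *)
Lemma dominant_exponents_diverge (r : R) (idx : nat -> I) (B : R) : 0 < r ->
  (forall n, dominant (r / 2 ^+ n) (idx n)) ->
  exists n, B <= \sum_(l < n) ratr (e (idx l)).
Proof.
move=> r0 dom; apply: contrapT => no.
have lt_B n : \sum_(l < n) ratr (e (idx l)) < B.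
  by rewrite ltNge; apply/negP => h; apply: no; exists n.
have rn0 n : 0 < r / 2 ^+ n by rewrite divr_gt0// exprn_gt0.
have h0 : 0 < 2^-1 :> R by rewrite invr_gt0.
(* Halving the radius multiplies the current dominant term by 2 ^ (- e), and the next dominant term
   is at least that large. *)
have lower n : coefsize r (idx 0%N) * 2^-1 `^ (\sum_(l < n) ratr (e (idx l)))
    <= coefsize (r / 2 ^+ n) (idx n).
  elim: n => [|n ih]; first by rewrite big_ord0 powRr0 expr0 divr1 mulr1.
  have [_ /(_ (idx n)) + _] := dom n.+1; apply: le_trans.
  rewrite big_ord_recr /= powRD; last by rewrite (gt_eqF h0) implybT.
  rewrite mulrA {2}/coefsize exprSr invfM mulrA powRM ?(ltW (rn0 _)) ?(ltW
    h0)//.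
  by rewrite mulrA ler_pM2r ?powR_gt0.
have [a0 _ _] := dom 0%N.
have c0 : 0 < coefsize r (idx 0%N) * 2^-1 `^ B by rewrite mulr_gt0 ?powR_gt0//
  coefsize_gt0.
have c20 : 0 < coefsize r (idx 0%N) * 2^-1 `^ B / 2 by rewrite divr_gt0.
have [rho rho0 rhoP] := coefsize_small c20.
have [n nrho] := exists_half_lt r0 rho0.
have := rhoP (r / 2 ^+ n) (idx n); rewrite (ltW (rn0 n)) (ltW nrho) => /(_ isT).
apply/negP; rewrite -ltNge (lt_le_trans _ (lower n))//.
rewrite (@lt_le_trans _ _ (coefsize r (idx 0%N) * 2^-1 `^ B))//.
  by rewrite ltr_pdivrMr// ltr_pMr// ltr1n.
rewrite ler_pM2l ?coefsize_gt0// /powR gt_eqF// ler_expR ler_wnM2r ?(ltW (lt_B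
  n))//.
by rewrite ln_le0// invf_le1// ler1n.
Qed.

(** The mirror image at 0 of the compactness criterion. Isolation at 0 suffices, as differences of
    zeros are zeros. *)
Lemma discrete_zerosP i0 : a i0 != 0 ->
  discrete_subset zeros <-> exists i, a i != 0 /\ forall j, a j != 0 ->
    e i <= e j.
Proof.
move=> ai0; split.
- move=> /(_ 0 fsum0)[_ [V /nbhs_ballP[eps /= eps0 epsV] VZ]].
  have iso z : zeros z -> abs z < eps -> z = 0.
    move=> Zz zeps; have : (V `&` zeros) z by split => //; apply: epsV;
      rewrite ball_absE sub0r absN.
    by rewrite VZ.
  have e20 : 0 < eps / 2 by rewrite divr_gt0.
  have [i' dom'] := exists_dominant e20 ai0.
  apply: contrapT => no; have [ai' _ _] := dom'.
  have [j aj ji'] : exists2 j, a j != 0 & e j < e i'.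
    apply: contrapT => noj; apply: no; exists i'; split => // j aj.
    by rewrite leNgt; apply/negP => ij; apply: noj; exists j.
  have [rho1 /andP[r10 r1e] r1P] := dominant_small e20 aj.
  have [i dom] := exists_dominant r10 ai0.
  have ii' : e i < e i'.
    rewrite (le_lt_trans _ ji')// leNgt; apply/negP => /(r1P rho1);
      rewrite r10 lexx => /(_ isT).
    by have [_ /(_ j)] := dom; rewrite leNgt => /negbTE ->.
  have [z Zz /andP[zr zr']] := exists_zero_between r10 r1e dom dom' ii'.
  have zeps : abs z < eps.
    by rewrite (le_lt_trans zr')// ltr_pdivrMr// ltr_pMr// ltr1n.
  by move: zr; rewrite (iso z Zz zeps) abs0 ltNge (ltW r10).
- move=> [M [aM minM]]; have [rho1 /andP[r10 _] r1P] := dominant_small ltr01 aM.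
  move=> x Zx; split; first by rewrite inE.
  exists (ball x rho1); first exact: nbhsx_ballx.
  apply/seteqP; split => [y [xy Zy]|y ->]; last by split => //; exact: ballxx.
  rewrite ball_absE in xy; apply/eqP; rewrite eq_sym -subr_eq0;
    apply/negPn/negP => z0.
  suff dom j : j != M -> coefsize (abs (x - y)) j < coefsize (abs (x - y)) M.
    have := strictly_dominant_fsum_neq0 z0 aM dom.
    by rewrite fsumB [fsum x]Zx [fsum y]Zy subrr eqxx.
  move=> jM; have [aj|aj] := eqVneq (a j) 0.
    by rewrite {1}/coefsize aj abs0 mul0r coefsize_gt0// abs_gt0.
  apply: r1P; first by rewrite abs_gt0 z0 ltW.
  by rewrite lt_neqAle minM// andbT eq_sym; apply: contra jM => /eqP/e_inj ->.
Qed.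

End Additive.

End Family.

(** * Haar measure of a compact subgroup *)

Section Separated.
Context {R : realType} {C : nonarchClosedFieldType R}.

Definition separated_seq (rho : R) (s : seq C) :=
  uniq s /\ forall x y, x \in s -> y \in s -> x != y -> rho < abs (x - y).

Lemma separated_filter rho (P : pred C) s : separated_seq rho s ->
  separated_seq rho [seq x <- s | P x].
Proof.
move=> [us sep]; split; first exact: filter_uniq.
by move=> x y; rewrite !mem_filter => /andP[_ xs] /andP[_ ys]; exact: sep.
Qed.

(** Two points of s sharing a center would be within rho of each other, by the ultrametric
    inequality. *)
Lemma separated_size_le rho (s t : seq C) : separated_seq rho s ->
  (forall x, x \in s -> exists2 y, y \in t & abs (x - y) <= rho) ->
  (size s <= size t)%N.
Proof.
move=> [us sep] cov.
have /choice[g gP] : forall x, exists y, x \in s ->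
  y \in t /\ abs (x - y) <= rho.
  move=> x; have [/cov[y]|] := boolP (x \in s); first by exists y.
  by exists 0.
rewrite -(size_map g); apply: uniq_leq_size; last first.
  by move=> _ /mapP[x xs ->]; have [] := gP _ xs.
rewrite map_inj_in_uniq// => x y xs ys gxy; apply/eqP/negPn/negP =>
  /(sep _ _ xs ys).
rewrite ltNge; apply/negP/negPn; apply: (absB_trans (gP _ xs).2).
by rewrite absBC gxy; exact: (gP _ ys).2.
Qed.

Lemma exists_separated_cover (A : set C) rho : 0 < rho -> totally_bounded A ->
  exists s, [/\ separated_seq rho s, forall x, x \in s -> A x &
    forall z, A z -> exists2 y, y \in s & abs (z - y) <= rho].
Proof.
move=> rho0 /(_ rho rho0)[s0 s0P].
(* Greedy selection: for the induction on [s0], s only has to cover the points of [A] near [s0]. The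
   centers in [s0] may lie outside [A], those in s may not. *)
have [s [sepA sA cov]] : exists s, [/\ separated_seq rho s, forall x, x \in s ->
  A x &
    forall z, A z -> (exists2 y, y \in s0 & abs (z - y) <= rho) ->
      exists2 y, y \in s & abs (z - y) <= rho].
  elim: {s0P} s0 => [|y s0 [s [[us sep] sA cov]]].
    by exists [::]; split => // z _ [].
  have [[z Az [zy nz]]|no] := pselect (exists2 z, A z &
      abs (z - y) <= rho /\ ~ exists2 x, x \in s & abs (z - x) <= rho);
        last first.
    exists s; split => // z Az [x]; rewrite inE => /predU1P[->{x} zy|xs zx];
      last first.
      by apply: cov => //; exists x.
    by apply: contrapT => nz; apply: no; exists z.
  have far x : x \in s -> rho < abs (z - x).
    by move=> xs; rewrite ltNge; apply/negP => zx; apply: nz; exists x.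
  exists (z :: s); split.
  - split.
      rewrite /= us andbT; apply/negP => /far; rewrite subrr abs0 ltNge ltW//.
    move=> u v; rewrite !inE => /predU1P[->|us'] /predU1P[->|vs].
    + by rewrite eqxx.
    + by move=> _; exact: far.
    + by move=> _; rewrite absBC; exact: far.
    + exact: sep.
  - by move=> x; rewrite inE => /predU1P[->|/sA].
  - move=> u Au [x]; rewrite inE => /predU1P[->{x} uy|xs ux].
      exists z; first exact: mem_head.
      by apply: (absB_trans uy); rewrite absBC.
    have [|v vs uv] := cov u Au; first by exists x.
    by exists v => //; rewrite inE vs orbT.
by exists s; split => // z Az; apply: cov => //; exact: s0P.
Qed.

End Separated.

Section HaarOuter.
Context {R : realType} {C : nonarchClosedFieldType R}.
Context (H : set C) (rho : nat -> R) (F : nat -> seq C).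

Definition meets j (A : set C) : pred C :=
  fun x => `[< exists2 z, (A `&` H) z & abs (z - x) <= rho j >].

Definition ncosets j A : nat := count (meets j A) (F j).

Definition coset_ratio j A : R := (ncosets j A)%:R / (size (F j))%:R.

(** With [F j] representing the cosets of H [&] Delta (rho j), each ratio is the proportion of
    cosets that [A] meets. A dense subset of [H] has content 1, so this is not additive and only
    feeds the outer measure. The discrete sigma-algebra admits covers by arbitrary sets. *)
Definition haar_content (A : set (g_sigma_algebraType [set: set C])) : \bar R :=
  ereal_inf [set (coset_ratio j A)%:E | j in setT].

Definition haar_outer : set C -> \bar R := mu_ext haar_content.

Lemma coset_ratio_ge0 j A : 0 <= coset_ratio j A.
Proof. by rewrite divr_ge0. Qed.

Lemma haar_content_le j A : (haar_content A <= (coset_ratio j A)%:E)%E.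
Proof. by apply: ereal_inf_lbound; exists j. Qed.

Lemma haar_content_ge0 A : (0 <= haar_content A)%E.
Proof.
by apply: le_ereal_inf_tmp => _ [j _ <-]; rewrite lee_fin coset_ratio_ge0.
Qed.

Lemma ncosets0 j A : (forall z, A z -> ~ H z) -> ncosets j A = 0%N.
Proof.
move=> AH; apply/eqP; rewrite -leqn0 leqNgt -has_count;
  apply/negP => /hasP[x _].
by move=> /asboolP[z [Az Hz] _]; exact: AH Hz.
Qed.

Lemma haar_content_eq0 A : (forall z, A z -> ~ H z) -> haar_content A = 0%E.
Proof.
move=> AH; apply/eqP; rewrite eq_le haar_content_ge0 andbT.
by rewrite (le_trans (haar_content_le 0 _))// /coset_ratio ncosets0// mul0r.
Qed.

Lemma haar_content0 : haar_content set0 = 0%E.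
Proof. exact: haar_content_eq0. Qed.

HB.instance Definition _ := isOuterMeasure.Build R C haar_outer
  (mu_ext0 haar_content0 haar_content_ge0) (mu_ext_ge0 haar_content_ge0)
  (le_mu_ext haar_content) (mu_ext_sigma_subadditive haar_content_ge0).

Lemma haar_outer_le A : (haar_outer A <= haar_content A)%E.
Proof.
apply: ereal_inf_lbound; exists (fun n => if n is 0%N then A else set0).
  split; first by move=> i; exact: sub_sigma_algebra.
  by move=> x Ax; exists 0%N.
rewrite (nneseriesD1 (n := 0%N))//; last by move=> *; exact: haar_content_ge0.
rewrite eseries0 ?adde0// => -[|i]//= _ _; exact: haar_content0.
Qed.

End HaarOuter.

Section Haar.
Context {R : realType} {C : nonarchClosedFieldType R}.
Context (H : set C) (rho : nat -> R) (F : nat -> seq C).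
Hypotheses (H0 : H 0) (HD : forall x y, H x -> H y -> H (x + y))
  (HN : forall x, H x -> H (- x)) (cH : compact H).
Hypotheses (rho_gt0 : forall j, 0 < rho j)
  (rho_homo : forall i j, (i <= j)%N -> rho j <= rho i)
  (rho_small : forall eps : R, 0 < eps -> exists j, rho j < eps).
Hypotheses (F_sep : forall j, separated_seq (rho j) (F j))
  (F_sub : forall j x, x \in F j -> H x)
  (F_cov : forall j z, H z -> exists2 y, y \in F j & abs (z - y) <= rho j).

Notation nc := (ncosets H rho F).
Notation ratio := (coset_ratio H rho F).
Notation content := (haar_content H rho F).
Notation mu := (haar_outer H rho F).

Lemma subgroupB x y : H x -> H y -> H (x - y).
Proof. by move=> Hx /HN; exact: HD. Qed.

Lemma size_F_gt0 j : (0 < size (F j))%N.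
Proof. by have [y] := F_cov j H0; case: (F j). Qed.

Lemma ncosets_le j A (t : seq C) :
  (forall z, A z -> H z -> exists2 y, y \in t & abs (z - y) <= rho j) ->
  (nc j A <= size t)%N.
Proof.
move=> cov; rewrite /ncosets -size_filter.
apply: (@separated_size_le _ _ (rho j)); first exact/separated_filter/F_sep.
move=> x; rewrite mem_filter => /andP[/asboolP[z [Az Hz] zx] _].
have [y yt zy] := cov _ Az Hz; exists y => //; apply: absB_trans zy.
by rewrite absBC.
Qed.

Lemma ncosets_cover j A z : A z -> H z ->
  exists2 y, y \in [seq y <- F j | meets H rho j A y] & abs (z - y) <= rho j.
Proof.
move=> Az Hz; have [y yF zy] := F_cov j Hz; exists y => //.
by rewrite mem_filter yF andbT; apply/asboolP; exists z.
Qed.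

Lemma ncosets_full j : nc j H = size (F j).
Proof.
apply/eqP; rewrite -all_count; apply/allP => x xF; apply/asboolP; exists x.
  by split; exact: F_sub xF.
by rewrite subrr abs0 ltW.
Qed.

Lemma coset_ratio_full j : ratio j H = 1.
Proof. by rewrite /coset_ratio ncosets_full divff// pnatr_eq0 -lt0n size_F_gt0.
  Qed.

(* All cosets of [H `&` Delta (rho j)] split into the same number of cosets
   of [H `&` Delta (rho i)]. *)
Lemma coset_ratio_le i j A : (j <= i)%N -> ratio i A <= ratio j A.
Proof.
move=> ji; pose K := H `&` Delta (rho j).
have tbK : totally_bounded K.
  by apply: sub_totally_bounded (compact_totally_boundedP cH) => z [].
have [k [[uk sepk] kK covk]] := exists_separated_cover (rho_gt0 i) tbK.
have le1 : (nc i A <= nc j A * size k)%N.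
  rewrite [X in (_ <= X * _)%N]/ncosets -size_filter -(size_allpairs (fun x y =>
    x + y)).
  apply: ncosets_le => z Az Hz; have [x xF zx] := ncosets_cover j Az Hz.
  have Hx : H x by move: xF; rewrite mem_filter => /andP[_ /F_sub].
  have [|y yk zxy] := covk (z - x); first by split => //; exact: subgroupB.
  exists (x + y); last by rewrite opprD addrA.
  by apply/allpairsP; exists (x, y).
(* Each coset of level j contains at least [size k] representatives of level i, while by [le1] those
   it contributes to [A] number at most [size k] on average. *)
have le2 : (size (F j) * size k <= size (F i))%N.
  have := @sum_count_le _ _ (fun x y => abs (y - x) <= rho j) predT (F j) (F i)
    (F_sep j).1.
  rewrite count_predT => le; apply: leq_trans (le _ _) => //; last first.
    move=> x x' y xF x'F yx yx'; apply/eqP/negPn/negP =>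
      /((F_sep j).2 _ _ xF x'F).
    by rewrite ltNge (absB_trans _ yx')// absBC.
  apply: (@leq_trans (\sum_(x <- F j) size k)).
    by rewrite big_const_seq count_predT iter_addn_0 mulnC.
  rewrite [X in (X <= _)%N]big_seq [X in (_ <= X)%N]big_seq;
    apply: leq_sum => x xF; rewrite -size_filter -[leqRHS](size_map (fun y =>
      y - x)).
  apply: (@separated_size_le _ _ (rho i)) => // c ck.
  have [Hc cj] := kK _ ck; have Hx := F_sub xF.
  have [y yF cy] := F_cov i (HD Hc Hx).
  exists (y - x); last by rewrite opprB addrA.
  apply/mapP; exists y => //; rewrite mem_filter yF andbT.
  rewrite absBC -[x](addrK c) addrAC.
  apply: absB_le; last exact: cj.
  by rewrite (addrC x) (le_trans cy)// rho_homo.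
rewrite /coset_ratio ler_pdivrMr ?ltr0n ?size_F_gt0// mulrAC ler_pdivlMr ?ltr0n
  ?size_F_gt0//.
rewrite -!natrM ler_nat (leq_trans (leq_mul le1 (leqnn _)))// -mulnA leq_mul//.
by rewrite mulnC.
Qed.

(** For a subset of [H], this says that it is a union of cosets of H [&] Delta (rho j). *)
Definition saturated j (B : set C) :=
  forall x y, H x -> H y -> abs (x - y) <= rho j -> B x -> B y.

(** At level max(i, j) no coset meets both parts of [A], so the two counts add up, and refining from
    i to that level does not increase the ratio. *)
Lemma haar_contentD j A B : saturated j B ->
  (content (A `&` B) + content (A `&` ~` B) <= content A)%E.
Proof.
move=> sB; apply: le_ereal_inf_tmp => _ [i _ <-]; pose l := maxn i j.
apply: (@le_trans _ _ (ratio l A)%:E); last by rewrite lee_fin coset_ratio_le//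
  leq_maxl.
apply: (@le_trans _ _ ((ratio l (A `&` B))%:E + (ratio l (A `&` ~` B))%:E)%E).
  by apply: leeD; exact: haar_content_le.
rewrite -EFinD lee_fin /coset_ratio -mulrDl ler_pM2r ?invr_gt0 ?ltr0n
  ?size_F_gt0//.
rewrite -natrD ler_nat /ncosets -count_predUI [X in (_ + X)%N](_ : _ = 0%N)
  ?addn0; last first.
  apply/eqP; rewrite -leqn0 leqNgt -has_count; apply/negP => /hasP[x _ /=].
  move=> /andP[/asboolP[z [[_ Bz] Hz] zx] /asboolP[z' [[_ nB] Hz'] zx']].
  apply: nB; apply: (sB z) => //.
  rewrite (absB_trans (y := x))//; first by rewrite (le_trans zx)// rho_homo//
    leq_maxr.
  by rewrite absBC (le_trans zx')// rho_homo// leq_maxr.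
apply: sub_count => x /= /orP[] /asboolP[z [[Az _] Hz] zx]; apply/asboolP;
  exists z => //.
Qed.

Lemma saturated_caratheodory j B : saturated j B -> mu.-caratheodory B.
Proof.
move=> sB; apply: le_caratheodory_measurable => X.
apply: le_ereal_inf_tmp => _ [A [_ XA] <-].
apply: (@le_trans _ _ (\sum_(k <oo) (content (A k `&` B) + content (A k `&` ~`
  B)))%E); last first.
  apply: lee_nneseries => [i _ _|i _]; last exact: haar_contentD sB.
  by rewrite adde_ge0// haar_content_ge0.
rewrite nneseriesD; last 2 first.
  by move=> *; exact: haar_content_ge0.
  by move=> *; exact: haar_content_ge0.
apply: leeD; apply: ereal_inf_lbound.
- exists (fun k => A k `&` B) => //; split; first by move=> i;
    exact: sub_sigma_algebra.
  by move=> x [/XA[k _ Ak] Bx]; exists k.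
- exists (fun k => A k `&` ~` B) => //; split; first by move=> i;
    exact: sub_sigma_algebra.
  by move=> x [/XA[k _ Ak] Bx]; exists k.
Qed.

Lemma open_caratheodory U : open U -> mu.-caratheodory U.
Proof.
(* Points whose whole coset of level j stays in [U]. Points of [U] outside [H] belong to every
   [S j], so the union is all of [U]. *)
move=> oU; pose S j := [set x | U x /\
  (H x -> forall y, H y -> abs (x - y) <= rho j -> U y)].
have -> : U = \bigcup_j S j.
  apply/seteqP; split => [x Ux|x [j _ []]//].
  have [eps eps0 xU] := open_abs_nbhs oU Ux; have [j jeps] := rho_small eps0.
  by exists j => //; split => // _ y _ xy; apply: xU; rewrite (le_lt_trans xy).
apply: caratheodory_measurable_bigcup => j; apply: (@saturated_caratheodory j).
move=> x y Hx Hy xy [Ux xP]; split; first exact: xP.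
by move=> _ z Hz yz; apply: xP => //; exact: absB_trans yz.
Qed.

Lemma borel_caratheodory (A : set (borelType C)) : measurable A ->
  mu.-caratheodory A.
Proof.
have : <<s @open C >> `<=` mu.-caratheodory.
  apply: smallest_sub; last by move=> U; exact: open_caratheodory.
  split.
  - exact: caratheodory_measurable_set0.
  - by move=> B mB; rewrite setTD; exact: caratheodory_measurable_setC.
  - by move=> B mB; exact: caratheodory_measurable_bigcup.
exact.
Qed.

Lemma ncosets_translate j h (A : set C) : H h ->
  (nc j [set (h + x)%R | x in A] <= nc j A)%N.
Proof.
move=> Hh; rewrite [leqRHS]/ncosets -size_filter -(size_map (fun x => h + x)).
apply: ncosets_le => _ [x Ax <-] Hhx.
have Hx : H x by rewrite -(addKr h x); apply: HD => //; exact: HN.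
have [y yF xy] := ncosets_cover j Ax Hx; exists (h + y); first exact: map_f.
by rewrite opprD addrACA subrr add0r.
Qed.

Lemma haar_outer_translate_le h (A : set C) : H h ->
  (mu [set (h + x)%R | x in A] <= mu A)%E.
Proof.
move=> Hh; apply: le_ereal_inf_tmp => _ [B [_ AB] <-].
apply: (@le_trans _ _ (\sum_(k <oo) content [set (h + x)%R | x in B k])%E).
  apply: ereal_inf_lbound; exists (fun k => [set h + x | x in B k]) => //.
  split; first by move=> i; exact: sub_sigma_algebra.
  by move=> _ [x /AB[k _ Bx] <-]; exists k => //; exists x.
apply: lee_nneseries => [*|k _]; first exact: haar_content_ge0.
apply: le_ereal_inf_tmp => _ [j _ <-]; apply: (le_trans (haar_content_le _ _ _
  j _)).
rewrite lee_fin /coset_ratio ler_pM2r ?invr_gt0 ?ltr0n ?size_F_gt0// ler_nat.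
exact: ncosets_translate.
Qed.

Lemma haar_outer_translate h (A : set C) : H h ->
  mu [set h + x | x in A] = mu A.
Proof.
move=> Hh; apply/eqP; rewrite eq_le haar_outer_translate_le//=.
have {1}-> : A = [set - h + x | x in [set h + x | x in A]].
  apply/seteqP; split => [x Ax|_ [_ [x Ax <-] <-]]; last by rewrite addKr.
  by exists (h + x); [exists x|rewrite addKr].
exact/haar_outer_translate_le/HN.
Qed.

Lemma haar_content_fin_num A : content A \is a fin_num.
Proof.
rewrite ge0_fin_numE ?haar_content_ge0//.
by rewrite (le_lt_trans (haar_content_le _ _ _ 0%N _))// ltry.
Qed.

(** The covering sets are arbitrary, so each is fattened to an open set meeting no new coset at its
    own level; compactness of [H] then reduces to a finite count at a common level. *)
Lemma haar_outer_full_ge1 : (1 <= mu H)%E.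
Proof.
apply: le_ereal_inf_tmp => _ [A [_ HA] <-].
apply/lee_addgt0Pr => eps eps0.
(* The level jn nearly attains the content of A_n, with errors summing to at most eps. *)
have /choice[jn jnP] : forall n, exists j, ((ratio j (A n))%:E <=
    content (A n) + (eps / (2 ^ n.+1)%:R)%:E)%E.
  move=> n; have en : 0 < eps / (2 ^ n.+1)%:R by rewrite divr_gt0// ltr0n
    expn_gt0.
  have [_ [j _ <-] jlt] := lb_ereal_inf_adherent en (haar_content_fin_num (A
    n)).
  by exists j; exact: ltW.
pose U n := [set x | exists2 z, (A n `&` H) z & abs (x - z) <= rho (jn n)].
have oU n : open (U n).
  apply: open_absP => x [z Az xz]; exists (rho (jn n)) => // y xy;
    exists z => //.
  by apply: absB_trans xz; rewrite absBC ltW.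
have [D _ HDU] : finite_subset_cover setT U H.
  move: cH; rewrite compact_cover; apply; first by move=> n _; exact: oU.
  move=> x Hx; have [n _ Ax] := HA x Hx; exists n => //; exists x => //.
  by rewrite subrr abs0 ltW.
pose M := (\max_(n <- D) n).+1; pose l := \max_(n < M) jn n.
have le_nc : (nc l H <= \sum_(0 <= n < M) nc l (U n))%N.
  rewrite (_ : \sum_(0 <= n < M) nc l (U n) =
      size (flatten [seq [seq y <- F l | meets H rho l (U n) y] | n <- iota 0
        M]))%N.
    apply: ncosets_le => z Hz _; have [n nD Uz] := HDU z Hz.
    have [y yF zy] := ncosets_cover l Uz Hz; exists y => //.
    apply/flattenP; exists [seq y <- F l | meets H rho l (U n) y] => //.
    by apply/mapP; exists n => //; rewrite mem_iota /= add0n ltnS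
      leq_bigmax_seq.
  rewrite size_flatten /shape -map_comp sumnE big_map /index_iota subn0.
  by apply: eq_bigr => n _; rewrite /= size_filter.
have le_ratio : 1 <= \sum_(0 <= n < M) ratio (jn n) (A n).
  rewrite -(coset_ratio_full l) (@le_trans _ _ (\sum_(0 <= n < M) ratio l (U
    n)))//.
    rewrite /coset_ratio -mulr_suml ler_pM2r ?invr_gt0 ?ltr0n ?size_F_gt0//.
    by rewrite -natr_sum ler_nat.
  rewrite !big_mkord; apply: ler_sum => n _.
  apply: (le_trans (coset_ratio_le (j := jn n) _ _)); first exact: leq_bigmax.
  rewrite /coset_ratio ler_pM2r ?invr_gt0 ?ltr0n ?size_F_gt0// ler_nat.
  apply: sub_count => x /asboolP[z [[z' Az' zz'] Hz] zx]; apply/asboolP.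
  by exists z' => //; apply: absB_trans zx; rewrite absBC.
apply: le_trans (epsilon_trick xpredT (fun n =>
  haar_content_ge0 H rho F (A n)) (ltW eps0)).
apply: (@le_trans _ _ (\sum_(0 <= n < M) (content (A n) + (eps / (2 ^
  n.+1)%:R)%:E))%E).
  apply: (@le_trans _ _ (\sum_(0 <= n < M) (ratio (jn n) (A n))%:E)%E).
    by rewrite sumEFin lee_fin.
  by apply: lee_sum => n _; exact: jnP.
apply: nneseries_lim_ge => n _ _; rewrite adde_ge0 ?haar_content_ge0//.
by rewrite lee_fin divr_ge0// ltW.
Qed.

Lemma haar_outer_cosets (s : seq C) (K : set C) : (forall x, x \in s -> H x) ->
  (mu [set z | exists2 x, x \in s & K (z - x)%R] <= (size s)%:R%:E * mu K)%E.
Proof.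
elim: s => [|x s ih] sH.
  rewrite (_ : [set z | _] = set0) ?outer_measure0 ?mul0e//.
  by apply/seteqP; split => // z [].
have xH : H x by apply: sH; exact: mem_head.
rewrite /= -addn1 natrD EFinD ge0_muleDl ?lee_fin// mul1e addeC.
rewrite (@le_trans _ _ (mu [set (x + y)%R | y in K] +
    mu [set z | exists2 x, x \in s & K (z - x)%R])%E)//.
  rewrite (le_trans _ (outer_measureU2 _ _ _))//; apply: le_outer_measure.
  move=> z [y]; rewrite inE => /predU1P[->{y} Kzx|ys Kzy]; last by right;
    exists y.
  by left; exists (z - x) => //; rewrite addrC subrK.
rewrite leeD// ?haar_outer_translate// ih// => y ys.
by apply: sH; rewrite inE ys orbT.
Qed.

(** The last clause, from covering [H] by translates of the small subgroup, gives the lower bound on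
    its measure from which the divergence is deduced. *)
Lemma exists_haar : exists m : {measure set (borelType C) -> \bar R},
  haar_on H m /\
  forall j, (m H <= (size (F j))%:R%:E * m (H `&` Delta (rho j)))%E.
Proof.
have additive : semi_sigma_additive (mu : set (borelType C) -> \bar R).
  move=> A mA tA mUA; apply: (@caratheodory_measure_sigma_additive R C mu A) =>
    //.
    by move=> n; exact: borel_caratheodory.
  exact: borel_caratheodory.
pose m : {measure set (borelType C) -> \bar R} :=
  HB.pack (mu : set (borelType C) -> \bar R)
  (isMeasure.Build _ _ _ (mu : set (borelType C) -> \bar R)
    (outer_measure0 mu) (outer_measure_ge0 mu) additive).
exists m; split; first split.
- apply/eqP; rewrite eq_le outer_measure_ge0 andbT.
  by rewrite (le_trans (haar_outer_le _ _ _ _))// haar_content_eq0.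
- exact: lt_le_trans haar_outer_full_ge1.
- rewrite (le_lt_trans (haar_outer_le _ _ _ _))//.
  by rewrite -ge0_fin_numE ?haar_content_fin_num ?haar_content_ge0.
- by move=> h A Hh _ _; exact: haar_outer_translate.
- move=> j; apply: le_trans (haar_outer_cosets _ (@F_sub j)).
  apply: le_outer_measure => z Hz; have [y yF zy] := F_cov j Hz.
  by exists y => //; split => //; apply: subgroupB => //; exact: F_sub yF.
Qed.

End Haar.

(** * Divergence of the integral of the valuation *)

Section ValuationIntegral.
Local Open Scope ereal_scope.
Context {R : realType} {C : nonarchClosedFieldType R}.

Lemma measurable_valuation (D : set (borelType C)) : measurable D ->
  measurable_fun D (valuation : borelType C -> \bar R).
Proof.
move=> mD; apply: (measurability _ (ErealGenOInfty.measurableE R)) => //.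
move=> _ [_ [y ->] <-]; apply: measurableI => //; apply: sub_sigma_algebra.
have -> : (valuation : C -> \bar R) @^-1` `]y%:E, +oo[%classic =
    ball (0%R : C) (expR (- y)%R).
  apply/seteqP; split => z; rewrite ball_absE sub0r absN /= in_itv /= andbT
    /valuation.
    case: eqVneq => [->|z0]; first by rewrite abs0 expR_gt0.
    have az0 : abs z \is Num.pos by rewrite posrE abs_gt0.
    by rewrite lte_fin ltrNr -[X in _ -> (X < _)%R](lnK az0) ltr_expR.
  case: eqVneq => [_ _|z0]; first by rewrite ltry.
  have az0 : abs z \is Num.pos by rewrite posrE abs_gt0.
  by rewrite -[X in (X < _)%R -> _](lnK az0) ltr_expR lte_fin ltrNr.
exact: open_abs_ball.
Qed.

(** The factor 2 in 2 r accounts for the index 0: if the last index counts, then 2 ^ (n + 1) |x| <=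
    2 r bounds the whole sum; otherwise the previous bound applies. *)
Lemma sum_ln2_le (r : R) (x : C) n : (0 < r)%R -> x != 0%R -> (abs x <= r)%R ->
  (ln 2 * \sum_(j < n) (abs x <= r / 2 ^+ j)%R%:R <= ln (2 * r) - ln (abs x))%R.
Proof.
move=> r0 x0 xr; have ax0 : (0 < abs x)%R by rewrite abs_gt0.
have r20 : (0 < 2 * r)%R by rewrite mulr_gt0.
elim: n => [|n ih].
  by rewrite big_ord0 mulr0 subr_ge0 ler_ln ?posrE// (le_trans xr)// ler_peMl
    ?ler1n// ltW.
have [xn|xn] := leP (abs x) (r / 2 ^+ n)%R; last first.
  by rewrite big_ord_recr /= (_ : (abs x <= _)%R = false) ?addr0// leNgt xn.
rewrite (@le_trans _ _ (ln 2 * n.+1%:R)%R)//.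
  rewrite ler_wpM2l ?ln_ge0 ?ler1n// -[n.+1 in leRHS]card_ord -sum1_card
    natr_sum.
  by apply: ler_sum => j _; rewrite ler_nat leq_b1.
rewrite mulr_natr -lnXn// lerBrDr -lnM ?posrE ?exprn_gt0// ler_ln ?posrE
  ?mulr_gt0 ?exprn_gt0//.
by rewrite exprS -mulrA ler_pM2l// mulrC -ler_pdivlMr ?exprn_gt0.
Qed.

(* [v + ln (2 r)] dominates [ln 2] times the number of indices [j < n] with
   [abs x <= r / 2 ^ j]. *)
Lemma integral_valuation_pinfty (mu : {measure set (borelType C) -> \bar R})
    (H : set C) (r : R) : (0 < r)%R -> closed H ->
      H `<=` Delta r -> mu H < +oo ->
  (forall B : R, exists n, B%:E <= \sum_(j < n) mu (H `&` Delta (r / 2 ^+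
    j)%R)) ->
  \int[mu]_(x in H) valuation x = +oo.
Proof.
move=> r0 clH Hr muH div.
have mclosed (A : set C) : closed A -> measurable (A : set (borelType C)).
  move=> clA; rewrite -[A]setCK; apply: (@measurableC _ (borelType C)).
  by apply: sub_sigma_algebra; exact: closed_openC.
pose K : set (borelType C) := H.
pose Kj j : set (borelType C) := H `&` Delta (r / 2 ^+ j)%R.
have mH : measurable K := mclosed _ clH.
have rj0 j : (0 < r / 2 ^+ j)%R by rewrite divr_gt0// exprn_gt0.
have mHj j : measurable (Kj j).
  by apply: mclosed; apply: closedI => //; exact: closed_Delta.
pose f : borelType C -> \bar R := valuation.
have mf : measurable_fun K f by exact: (measurable_valuation mH).
(* Taken nonnegative so that it bounds the shift and, as |x| <= 2 r on [H], also the negative part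
   of the valuation. *)
pose c : R := `|ln (2 * r)|%R.
have muHfin : mu K \is a fin_num by rewrite ge0_fin_numE// measure_ge0.
have cmu : (c%:E * mu K) \is a fin_num by rewrite fin_numM.
pose h j (x : borelType C) : \bar R := (ln 2 * \1_(Kj j) x)%:E.
pose g n (x : borelType C) : \bar R := \sum_(j < n) h j x.
have ln20 : (0 < ln 2 :> R)%R by rewrite ln_gt0// ltr1n.
have h_ge0 j x : 0 <= h j x.
  by rewrite /h lee_fin mulr_ge0 ?(ltW ln20)// indicE ler0n.
have g_le n x : H x -> g n x <= f^\+ x + c%:E.
  move=> Hx; have [x0|x0] := eqVneq (x : C) 0%R.
    have -> : f^\+ x = +oo by rewrite funeposE /f /valuation x0 eqxx maxye.
    by rewrite addye// leey.
  apply: (@le_trans _ _ (f x + c%:E)); last first.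
    by rewrite leeD2r// funeposE le_max lexx.
  rewrite /f /valuation (negbTE x0) /g /h sumEFin -EFinD lee_fin -mulr_sumr.
  have -> : (\sum_(j < n) \1_(Kj j) x =
      \sum_(j < n) (abs (x : C) <= r / 2 ^+ j)%R%:R :> R)%R.
    apply: eq_bigr => j _; rewrite indicE; congr (_%:R); congr nat_of_bool.
    by apply/idP/idP => [|xr]; rewrite inE; [case|split].
  rewrite (le_trans (sum_ln2_le _ r0 x0 (Hr _ Hx)))// addrC lerD2l.
  exact: ler_norm.
have mg j : measurable_fun K (h j).
  by apply/measurable_EFinP; apply: measurable_funM => //;
    exact: measurable_indic.
have int_g n : \int[mu]_(x in K) g n x =
    (ln 2)%:E * \sum_(j < n) mu (Kj j).
  rewrite /g (ge0_integral_sum mu mH (fun j : 'I_n => mg j))//.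
  rewrite ge0_sume_distrr//.
  apply: eq_bigr => j _; rewrite /h; under eq_integral do rewrite EFinM.
  rewrite ge0_integralZl// ?lee_fin ?(ltW ln20)//; last first.
    by apply/measurable_EFinP; exact: measurable_indic.
  rewrite integral_indic//; congr (_ * mu _).
  by apply/seteqP; split => [x [[]]//|x [Hx xr]]; split => //; split.
have mfp : measurable_fun K f^\+ by exact: measurable_funepos.
have mfn : measurable_fun K f^\- by exact: measurable_funeneg.
have mc : measurable_fun K (cst c%:E : borelType C -> \bar R) by [].
have c0 x : K x -> 0 <= (cst c%:E : borelType C -> \bar R) x.
  by rewrite lee_fin normr_ge0.
have le_g n : (ln 2)%:E * \sum_(j < n) mu (Kj j) <=
    \int[mu]_(x in K) f^\+ x + c%:E * mu K.
  rewrite -int_g -integral_cst// -ge0_integralD//.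
  apply: (ge0_le_integral mu mH).
  - by move=> x _; apply: sume_ge0 => j _; exact: h_ge0.
  - by apply: emeasurable_sum => j; exact: mg.
  - exact: emeasurable_funD.
  - by move=> x; exact: g_le.
have pos : \int[mu]_(x in K) f^\+ x = +oo.
  apply/eqyP => B _; have [n nB] := div ((B + fine (c%:E * mu K)) / ln 2)%R.
  have le_B : (B + fine (c%:E * mu K))%:E <=
      \int[mu]_(x in K) f^\+ x + c%:E * mu K.
    by apply: le_trans (le_g n); rewrite -lee_pdivrMl// -EFinM mulrC.
  by move: le_B; rewrite EFinD fineK// leeD2rE.
(* Finiteness of the negative part excludes a difference of two infinities. *)
have neg : \int[mu]_(x in K) f^\- x <= c%:E * mu K.
  rewrite -integral_cst//; apply: (ge0_le_integral mu mH) => // x Hx.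
  rewrite funenegE ge_max lee_fin normr_ge0 andbT /f /valuation.
    case: eqVneq => [_|x0]; first by rewrite leNye.
    rewrite -EFinN lee_fin opprK (le_trans _ (ler_norm _))//.
    rewrite ler_ln ?posrE ?abs_gt0 ?mulr_gt0// (le_trans (Hr _ Hx))//.
    by rewrite ler_peMl ?ler1n// ltW.
rewrite -/K -/f integralE pos addye// eqe_oppLR /=.
by rewrite lt_eqF// (le_lt_trans neg)// ltey_eq cmu.
Qed.

End ValuationIntegral.

(** * Kernels of additive series *)

Section SubgroupCosets.
Context {R : realType} {C : nonarchClosedFieldType R} (G : set C) (r : R).
Hypotheses (r0 : 0 < r) (GD : forall x y, G x -> G y -> G (x + y))
  (GN : forall x, G x -> G (- x))
  (tbG : forall rho, 0 < rho -> totally_bounded (G `&` Delta rho)).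

(** For each n, total boundedness leaves finitely many cosets with a representative in the disc of
    radius n + 1. *)
Lemma countable_cosets : countable (cosets G (G `&` Delta r)).
Proof.
have n0 n : 0 < n.+1%:R :> R by rewrite ltr0n.
have /choice[s sP] : forall n, exists s : seq C, (forall x, x \in s -> G x) /\
    forall z, (G `&` Delta n.+1%:R) z -> exists2 y, y \in s & abs (z - y) <= r.
  move=> n; have [s [_ sG cov]] := exists_separated_cover r0 (tbG (n0 n)).
  by exists s; split => // x /sG[].
pose co (y : C) := [set y + h | h in G `&` Delta r].
have cU : countable (\bigcup_n [set co y | y in [set` s n]]).
  apply: bigcup_countable => // n _.
  by apply: finite_set_countable; apply: finite_image; exact: finite_seq.
apply: sub_countable cU; apply: subset_card_le => _ [x Gx <-].
have [n xn] : exists n : nat, abs x <= n.+1%:R.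
  by exists (Num.bound (abs x)); rewrite ltW// (lt_trans (archi_boundP (abs_ge0
    _)))// ltr_nat.
have [y ys xy] := (sP n).2 x (conj Gx xn); have Gy := (sP n).1 y ys.
exists n => //; exists y => //.
have sub u v : G u -> G v -> abs (u - v) <= r -> co u `<=` co v.
  move=> Gu Gv uv _ [h [Gh hr] <-]; exists (u - v + h).
    split; last by rewrite /Delta /= absD_le.
    by apply: GD => //; apply: GD => //; exact: GN.
  by rewrite addrA addrCA subrr addr0.
by apply/seteqP; split; apply: sub => //; rewrite absBC.
Qed.

(** A ball of radius r contains at most one g_n, and finitely many such balls cover the part of [G]
    in a given disc. *)
Lemma coset_reps_cvg (g : nat -> C) : coset_reps G (G `&` Delta r) g ->
  abs (g n) @[n --> \oo] --> +oo.
Proof.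
move=> [gG gP]; apply/cvgryPgt => A.
have A0 : 0 < Num.max A 1 by rewrite lt_max ltr01 orbT.
have inj m n : abs (g m - g n) <= r -> m = n.
  move=> mn; have [l [_ uniql]] := gP _ (gG m).
  have Gmn : G (g m - g n) by apply: GD => //; exact: GN.
  rewrite -(uniql n) ?(uniql m)//; split => //.
    by rewrite subrr -(subrr (g m)); apply: GD => //; exact: GN.
  by rewrite /Delta /= subrr abs0 ltW.
have [s sP] := tbG A0 r0.
have [N NP] : exists N, forall n, (N <= n)%N ->
  forall y, y \in s -> r < abs (g n - y).
  elim: {sP} s => [|y s [N NP]]; first by exists 0%N.
  have [[n0 n0y]|no] := pselect (exists n0, abs (g n0 - y) <= r); last first.
    exists N => n Nn z; rewrite inE => /predU1P[->|]; last exact: NP.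
    by rewrite ltNge; apply/negP => ny; apply: no; exists n.
  exists (maxn N n0.+1) => n; rewrite geq_max => /andP[Nn n0n] z.
  rewrite inE => /predU1P[->|]; last exact: NP.
  rewrite ltNge; apply/negP => ny.
  have /inj nE : abs (g n - g n0) <= r by apply: (absB_trans ny); rewrite absBC.
  by move: n0n; rewrite nE ltnn.
exists N => // n /= Nn; rewrite ltNge; apply/negP => gA.
have [|y ys] := sP (g n); first by split => //; rewrite /Delta /= le_max gA.
by rewrite leNgt NP.
Qed.

End SubgroupCosets.

Section AdditiveHaar.
Context {R : realType} {C : nonarchClosedFieldType R} (p : nat).
Hypotheses (Ccomplete : complete_space C) (p_pr : prime p) (pC : p \in [pchar
  C]).
Context (I : choiceType) (a : I -> C) (e : I -> rat).
Hypotheses (e_inj : injective e) (eE : forall i, expoE p (e i))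
  (conv : forall z : C, tends_to_0 (fun i => a i * powE z (e i)))
  (e_pow : forall i, exists m : int, e i = p%:R ^ m).

Lemma exists_haar_valuation (r : R) (i0 : I) : 0 < r -> a i0 != 0 ->
  exists mu : {measure set (borelType C) -> \bar R},
    haar_on (zeros a e `&` Delta r) mu /\
    (\int[mu]_(x in zeros a e `&` Delta r) valuation x)%E = +oo%E.
Proof.
move=> r0 ai0; set H := zeros a e `&` Delta r.
have fD := fsumD Ccomplete p_pr pC eE conv e_pow.
have fN := fsumN Ccomplete p_pr pC eE conv e_pow.
have f0 := fsum0 Ccomplete p_pr pC eE conv e_pow.
have tbH : totally_bounded H by exact: (totally_bounded_zeros Ccomplete p_pr pC
  e_inj eE conv r0 ai0).
pose rho j : R := r / 2 ^+ j.
have rho0 j : 0 < rho j by rewrite divr_gt0// exprn_gt0.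
have rho_le i j : (i <= j)%N -> rho j <= rho i.
  move=> ij; rewrite ler_pM2l// lef_pV2 ?posrE ?exprn_gt0// ler_eXn2l// ltr1n//.
have rhor j : rho j <= r by rewrite (le_trans (rho_le 0%N j _))// /rho expr0
  divr1.
have /choice[F FP] : forall j, exists s : seq C, [/\ separated_seq (rho j) s,
    forall x, x \in s -> H x & forall z, H z ->
      exists2 y, y \in s & abs (z - y) <= rho j].
  by move=> j; exact: exists_separated_cover.
have [||||||||||mu [haar muF]] := @exists_haar R C H rho F.
- by split => //; rewrite /Delta /= abs0 ltW.
- move=> x y [Zx xr] [Zy yr]; split; last exact: absD_le.
  by rewrite /zeros /= fD [fsum a e x]Zx [fsum a e y]Zy addr0.
- move=> x [Zx xr]; split; last by rewrite /Delta /= absN.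
  by rewrite /zeros /= fN [fsum a e x]Zx oppr0.
- exact: (compact_zeros_Delta Ccomplete p_pr pC e_inj eE conv r0 ai0).
- by [].
- by [].
- by move=> eps; exact: exists_half_lt.
- by move=> j; have [] := FP j.
- by move=> j; have [] := FP j.
- by move=> j; have [] := FP j.
exists mu; split => //; have [_ muH0 muHoo _] := haar.
have clH : closed H.
  by apply: closedI; [exact: (closed_zeros Ccomplete p_pr pC eE conv)|exact:
    closed_Delta].
apply: (integral_valuation_pinfty r0 clH _ muHoo); first by move=> x [].
have /choice[idx dom] : forall j, exists i, dominant a e (rho j) i.
  by move=> j; exact: (exists_dominant p_pr pC eE conv (rho0 j) ai0).
have [ir domr] := exists_dominant p_pr pC eE conv r0 ai0.
have er0 : 0 < ratr (e ir) :> R by rewrite ltr0q (e_gt0 p_pr e_pow).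
have muHE : mu H = (fine (mu H))%:E by rewrite fineK// ge0_fin_numE//
  measure_ge0.
have M0 : 0 < fine (mu H) by rewrite -lte_fin -muHE.
(* Covering by cosets gives mu(H) <= |F_j| mu(H [&] Delta (rho j)), and the root count gives |F_j|
   e(idx j) <= e(ir). *)
have lower j : ((fine (mu H) / ratr (e ir) * ratr (e (idx j)))%:E <=
    mu (H `&` Delta (rho j)))%E.
  have [[uF sepF] FH _] := FP j.
  have le_e : (size (F j))%:R * e (idx j) <= e ir.
    apply: (separated_zeros_le Ccomplete p_pr pC e_inj eE conv e_pow (rho0 j)
      (rhor j)
      domr (dom j) uF) => //.
    by move=> h /FH[Zh hr].
  have {}le_e : (size (F j))%:R * ratr (e (idx j)) <= ratr (e ir) :> R.
    by rewrite -(ratr_nat R) -rmorphM /= ler_rat.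
  have := muF j; rewrite muHE.
  have : (0 <= mu (H `&` Delta (rho j)))%E by exact: measure_ge0.
  case: (mu (H `&` Delta (rho j))) => [y|_ _|//]; last by rewrite leey.
  rewrite -EFinM !lee_fin => y0 le_y; rewrite mulrAC ler_pdivrMr//.
  apply: (@le_trans _ _ ((size (F j))%:R * y * ratr (e (idx j)))).
    by rewrite ler_wpM2r// ler0q (expoE_ge0 (eE _)).
  by rewrite mulrAC mulrC ler_wpM2l.
move=> B; have [n nB] := dominant_exponents_diverge p_pr pC eE conv e_pow
  (B * ratr (e ir) / fine (mu H)) r0 dom.
exists n; apply: (@le_trans _ _ (\sum_(j < n) (fine (mu H) / ratr (e ir) * ratr
  (e (idx j)))%:E)%E).
  rewrite sumEFin lee_fin -mulr_sumr mulrAC ler_pdivlMr// mulrC.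
  by rewrite [leRHS]mulrC -ler_pdivrMr// (mulrC _ B).
by apply: lee_sum => j _; exact: lower.
Qed.

End AdditiveHaar.

(** * Linearity over the finite field and exponents q ^ n *)

Section FqLinear.
Context {R : realType} {C : nonarchClosedFieldType R} (p s : nat)
  (k : finFieldType) (iota : {rmorphism k -> C}).
Hypotheses (p_pr : prime p) (pC : p \in [pchar C]) (k_card : #|k| = (p ^ s)%N).
Let q : nat := (p ^ s)%N.

(** Rules out s = 0, because a field has at least two elements. *)
Lemma q_gt1 : (1 < q)%N.
Proof. by rewrite /q -k_card finNzRing_gt1. Qed.

Let e (n : int) : rat := q%:R ^ n.

Lemma expq_le (m n : int) : (e m <= e n) = (m <= n).
Proof. by rewrite /e ler_eXz2l// ltr1n q_gt1. Qed.

Lemma expq_inj : injective e.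
Proof.
apply: ieexprIz; first by rewrite ltr0n ltnW// q_gt1.
by rewrite pnatr_eq1 gtn_eqF// q_gt1.
Qed.

Lemma expq_pow n : exists m : int, e n = p%:R ^ m.
Proof. by exists (s%:Z * n); rewrite /e /q natrX -exprz_exp. Qed.

Lemma expq_expoE n : expoE p (e n).
Proof. by have [m ->] := expq_pow n; exists 1%N, m; rewrite mul1r. Qed.

Lemma iota_expq l n : iota l ^+ (q ^ n) = iota l.
Proof.
elim: n => [|n ih]; first by rewrite expn0 expr1.
by rewrite expnSr exprM ih -rmorphXn /q -k_card expf_card.
Qed.

(** The image of the finite field is fixed by the q-Frobenius; for negative n the factor [iota l] is
    its own q-power root. *)
Lemma powE_linear l (x : C) n : powE (iota l * x) (e n) = iota l * powE x (e n).
Proof.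
have q0 : q%:R != 0 :> rat by rewrite pnatr_eq0 -lt0n ltnW// q_gt1.
have qE n' : (q ^ n')%N = (p ^ (s * n'))%N by rewrite /q expnM.
case: n => n.
  have E (z : C) : powE z (e n) = z ^+ (q ^ n).
    by apply: (@powE_root _ _ _ p_pr pC z z _ 0%N);
      rewrite ?expr1// expn0 mulr1 natrX.
  by rewrite !E exprMn iota_expq.
have E (w : C) : powE (w ^+ (q ^ n.+1)) (e (Negz n)) = w.
  rewrite (@powE_root _ _ _ p_pr pC _ w _ (s * n.+1) 1) ?expr1 ?qE//.
  by rewrite -qE /e NegzE -exprnN natrX mulVf ?expf_neq0.
have [|w <-] := @exists_root _ _ (q ^ n.+1) x;
  first by rewrite expn_gt0 ltnW// q_gt1.
by rewrite E -{1}(iota_expq l n.+1) -exprMn E.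
Qed.

Lemma zeros_linear (a : int -> C) l x : complete_space C -> inF q a ->
  zeros a e x -> zeros a e (iota l * x).
Proof.
move=> Ccomplete conv Zx; apply: abs_le0_eq => eps eps0.
pose rho := Num.max (abs x) (abs (iota l * x)).
have L0 : 0 < abs (iota l) + 1 by rewrite ltr_wpDl ?abs_ge0.
have d0 : 0 < eps / (abs (iota l) + 1) by rewrite divr_gt0.
have approx z : abs z <= rho -> abs (fsum a e z -
    \sum_(n <- bigidx a e rho (eps / (abs (iota l) + 1))) a n * powE z (e n))
      <= eps / (abs (iota l) + 1).
  by move=> zr; exact: (fsum_approx Ccomplete p_pr pC expq_expoE conv d0 zr
    (fsubset_refl _)).
have xr : abs x <= rho by rewrite le_max lexx.
have lxr : abs (iota l * x) <= rho by rewrite le_max lexx orbT.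
have := approx _ xr; rewrite [fsum a e x]Zx sub0r absN => fx.
rewrite -(subrK (\sum_(n <- bigidx a e rho (eps / (abs (iota l) + 1)))
  a n * powE (iota l * x) (e n)) (fsum a e (iota l * x))).
apply: absD_le.
  rewrite (le_trans (approx _ lxr))// ler_pdivrMr// ler_peMr ?(ltW eps0)//.
  by rewrite lerDr abs_ge0.
under eq_bigr do rewrite powE_linear mulrCA.
rewrite -mulr_sumr absM (le_trans (ler_wpM2l (abs_ge0 _) fx))//.
by rewrite mulrA ler_pdivrMr// mulrC ler_pM2l// lerDl.
Qed.

Lemma exists_min_intP (a : int -> C) n0 : a n0 != 0 ->
  (exists i, a i != 0 /\ forall j, a j != 0 -> e i <= e j) <->
  exists N : int, forall n : int, n < N -> a n = 0.
Proof.
move=> an0; split.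
  move=> [i [ai mini]]; exists i => n ni; apply/eqP/negPn/negP => /mini.
  by rewrite expq_le leNgt ni.
move=> [N NP]; have ge_N n : a n != 0 -> exists m : nat, n = N + m%:Z.
  move=> an; have Nn : N <= n by rewrite leNgt; apply/negP => /NP/eqP;
    exact/negP.
  by exists `|n - N|%N; rewrite gez0_abs ?subr_ge0// [RHS]addrC subrK.
have ex : exists m : nat, a (N + m%:Z) != 0.
  by have [m E] := ge_N _ an0; exists m; rewrite -E.
case: (ex_minnP ex) => m am minm; exists (N + m%:Z); split => // j aj.
by have [m' E] := ge_N _ aj; rewrite expq_le E lerD2l lez_nat minm// -E.
Qed.

Lemma exists_max_intP (a : int -> C) n0 : a n0 != 0 ->
  (exists i, a i != 0 /\ forall j, a j != 0 -> e j <= e i) <->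
  exists N : int, forall n : int, N < n -> a n = 0.
Proof.
move=> an0; split.
  move=> [i [ai maxi]]; exists i => n ni; apply/eqP/negPn/negP => /maxi.
  by rewrite expq_le leNgt ni.
move=> [N NP]; have le_N n : a n != 0 -> exists m : nat, n = N - m%:Z.
  move=> an; have Nn : n <= N by rewrite leNgt; apply/negP => /NP/eqP;
    exact/negP.
  by exists `|N - n|%N; rewrite gez0_abs ?subr_ge0// subKr.
have ex : exists m : nat, a (N - m%:Z) != 0.
  by have [m E] := le_N _ an0; exists m; rewrite -E.
case: (ex_minnP ex) => m am minm; exists (N - m%:Z); split => // j aj.
by have [m' E] := le_N _ aj; rewrite expq_le E lerD2l lerN2 lez_nat minm// -E.
Qed.

End FqLinear.

(** * Fibers as zero sets: changing the constant coefficient *)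

Section SubtractConstant.
Context {R : realType} {C : nonarchClosedFieldType R} (p : nat).
Hypotheses (Ccomplete : complete_space C) (p_pr : prime p) (pC : p \in [pchar
  C]).
Context (a : expoE p -> C) (c : C).
Hypothesis conv : inP a.
Let e (i : expoE p) : rat := val i.

Definition sub_const (i : expoE p) : C := if val i == 0 then a i - c else a i.

Lemma expoE0 : expoE p 0.
Proof. by exists 0%N, 0; rewrite mul0r. Qed.

Let i0 : expoE p := SigSub (mem_set expoE0).

Lemma powE0 (z : C) : powE z 0 = 1.
Proof. by rewrite /powE (_ : numq 0 = 0) ?expr0. Qed.

Lemma sub_const0 : sub_const i0 = a i0 - c.
Proof. by []. Qed.

Lemma sub_constE i : i != i0 -> sub_const i = a i.
Proof.
by move=> ii0; rewrite /sub_const ifN//; apply: contra ii0 => /eqP i0E;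
  apply/eqP/val_inj.
Qed.

Lemma inP_sub_const : inP sub_const.
Proof.
move=> z eps eps0.
apply: (@sub_finite_set _ _ ([set i | eps < abs (termP a z i)] `|` [set i0]));
  last first.
  by rewrite finite_setU; split => //; exact: conv.
move=> i /= h; have [->|ii0] := eqVneq i i0; [by right|left].
by move: h; rewrite /termP sub_constE.
Qed.

Lemma fsum_sub_const z : fsum sub_const e z = evalP a z - c.
Proof.
have eE i : expoE p (e i) by exact: set_valP.
apply/eqP; rewrite -subr_eq0; apply/eqP; apply: abs_le0_eq => eps eps0.
(* One index set approximates both series and contains the exponent 0, where they differ by exactly
   c. *)
pose J := (i0 |` (bigidx a e (abs z) eps `|` bigidx sub_const e (abs z)
  eps))%fset.
have J0 : i0 \in J by rewrite fset1U1.
have h1 := fsum_approx Ccomplete p_pr pC eE conv (J := J) eps0 (lexx (abs z)).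
have h2 := fsum_approx Ccomplete p_pr pC eE inP_sub_const (J :=
  J) eps0 (lexx (abs z)).
have {}h1 := h1 (fsubset_trans (fsubsetUl _ _) (fsubsetU1 _ _)).
have {}h2 := h2 (fsubset_trans (fsubsetUr _ _) (fsubsetU1 _ _)).
have sumE : \sum_(i <- J) sub_const i * powE z (e i) = \sum_(i <- J) a i * powE
  z (e i) - c.
  rewrite !(bigD1_seq i0 J0 (fset_uniq J)) /= sub_const0 [e i0]/(0 : rat) powE0
    !mulr1 [RHS]addrAC.
  by congr (_ + _); apply: eq_bigr => i ii0; rewrite sub_constE.
have -> : fsum sub_const e z - (evalP a z - c) =
    (fsum sub_const e z - \sum_(i <- J) sub_const i * powE z (e i)) -
    (fsum a e z - \sum_(i <- J) a i * powE z (e i)).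
  by rewrite sumE !opprB -addrA subrKA.
by apply: absB_le.
Qed.

End SubtractConstant.

(** With a nonzero coefficient at a positive exponent, the largest exponent is positive, so the
    constant coefficient cannot affect it. *)
Lemma largest_exponent_ext (R : realType) (C : nonarchClosedFieldType R)
    (p : nat) (a b : expoE p -> C) : (forall i, val i != 0 -> a i = b i) ->
  (exists i, val i != 0 /\ a i != 0) ->
  (exists i, a i != 0 /\ forall j, a j != 0 -> val j <= val i) ->
  exists i, b i != 0 /\ forall j, b j != 0 -> val j <= val i.
Proof.
move=> ab [i1 [vi1 ai1]] [i [ai maxi]].
have pos (j : expoE p) : 0 <= val j by exact: (@expoE_ge0 p _ (set_valP j)).
have vi : val i != 0.
  rewrite gt_eqF// (lt_le_trans _ (maxi _ ai1))// lt_neqAle eq_sym vi1.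
  exact: pos.
exists i; split; first by rewrite -ab.
move=> j bj; have [->|vj] := eqVneq (val j) 0; first exact: pos.
by apply: maxi; rewrite ab.
Qed.

Theorem theorem5p4 (R : realType) (C : nonarchClosedFieldType R)
    (p q : nat) (k : finFieldType) (iota : {rmorphism k -> C}) (r : R) :
  complete_space C ->
  prime p -> (exists s : nat, q = (p ^ s)%N) -> #|k| = q -> 0 < r ->
  (forall a : expoE p -> C, inP a -> (exists e, val e != 0 /\ a e != 0) ->
    forall c : C,
      locally_compact_subset (evalP a @^-1` [set c]) /\
      (compact (evalP a @^-1` [set c]) <->
       exists e, a e != 0 /\ forall e', a e' != 0 -> val e' <= val e)) /\
  (forall a : int -> C, inF q a -> (exists n, a n != 0) ->
    inG iota r (kerF q a) /\
    (discrete_subset (kerF q a) <->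
     exists N : int, forall n : int, n < N -> a n = 0) /\
    (compact (kerF q a) <->
     exists N : int, forall n : int, N < n -> a n = 0)).
Proof.
move=> Ccomplete p_pr [s ->] k_card r0.
have pC : p \in [pchar C] by exact: (rmorph_pchar iota (card_finPcharP k_card
  p_pr)).
split.
- move=> a conv nonconst c; have conv' := inP_sub_const c conv.
  pose e (i : expoE p) : rat := val i.
  have eE i : expoE p (e i) by exact: set_valP.
  have e_inj : injective e by exact: val_inj.
  have agree i : val i != 0 -> a i = sub_const a c i.
    by move=> vi; rewrite /sub_const ifN.
  have fiberE : evalP a @^-1` [set c] = zeros (sub_const a c) e.
    apply/seteqP; split => z /=; rewrite /zeros /= fsum_sub_const//.
      by move=> ->; rewrite subrr.
    by move=> /eqP; rewrite subr_eq0 => /eqP.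
  have [i1 [vi1 ai1]] := nonconst.
  have ai1' : sub_const a c i1 != 0 by rewrite -agree.
  rewrite fiberE; split.
    apply: locally_compact_subsetP => rho rho0.
    exact: (compact_zeros_Delta Ccomplete p_pr pC e_inj eE conv' rho0 ai1').
  rewrite (compact_zerosP Ccomplete p_pr pC e_inj eE conv' ai1'); split => h.
    apply: largest_exponent_ext h => //; last by exists i1.
    by move=> i vi; rewrite agree.
  by apply: largest_exponent_ext h.
- move=> a conv [n0 an0]; pose e (n : int) : rat := (p ^ s)%N%:R ^ n.
  have e_inj : injective e := expq_inj k_card.
  have eE : forall n, expoE p (e n) := expq_expoE p s.
  have e_pow : forall n, exists m : int, e n = p%:R ^ m := expq_pow p s.
  (* The kernel is by definition the zero set of the family indexed by [int]. *)
  change (kerF (p ^ s) a) with (zeros a e).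
  have fD := fsumD Ccomplete p_pr pC eE conv e_pow.
  have fN := fsumN Ccomplete p_pr pC eE conv e_pow.
  have GD x y : zeros a e x -> zeros a e y -> zeros a e (x + y).
    by rewrite /zeros /= fD => -> ->; rewrite addr0.
  have GN x : zeros a e x -> zeros a e (- x).
    by rewrite /zeros /= fN => ->; rewrite oppr0.
  have tbG rho : 0 < rho -> totally_bounded (zeros a e `&` Delta rho).
    by move=> rho0; exact: (totally_bounded_zeros Ccomplete p_pr pC e_inj eE
      conv rho0 an0).
  split; last split.
  + split.
    * split; [exact: (fsum0 Ccomplete p_pr pC eE conv e_pow)|exact: GD|].
      by move=> l x; apply: (zeros_linear iota p_pr pC k_card).
    * exact: (compact_zeros_Delta Ccomplete p_pr pC e_inj eE conv r0 an0).
    * exact: (exists_haar_valuation Ccomplete p_pr pC e_inj eE conv e_pow r0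
        an0).
    * exact: countable_cosets.
    * by move=> g; exact: coset_reps_cvg.
  + rewrite (discrete_zerosP Ccomplete p_pr pC e_inj eE conv e_pow an0).
    exact: (exists_min_intP k_card an0).
  + rewrite (compact_zerosP Ccomplete p_pr pC e_inj eE conv an0).
    exact: (exists_max_intP k_card an0).
Qed.
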